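(* Fix $t\ge0$, let $x\in(0,1)$ satisfy $x+F_t(r-cx)=1$ and suppose that $\alpha:=cf_t(r-cx)>1$. Then $$\liminf_{\varepsilon\to0}\liminf_{n\to\infty}P\big(\exists\,k\in\mathcal{K}_{n,t}:\ |x-\tfrac{k}{n}|<\varepsilon\big)\ge L(\alpha)>0,$$ where $$L(\alpha)=\frac{e^{-\alpha}}{(\alpha-1)\left(1+2\sqrt{\frac{2}{|a_0|}}\left\{1-\Phi\big(\sqrt{2|a_0|}\big)\right\}\right)}$$ with $a_0:=1-\alpha+\log(\alpha)<0$ and $\Phi$ the standard normal c.d.f.
   Context: $r\in\mathbb{R}$ and $c>0$ are constants. For the fixed time $t$, the signals $Y^1_t,Y^2_t,\dots$ are i.i.d. $[0,\infty)$-valued random variables on a probability space $(\Omega,\mathcal{G},P)$ with c.d.f. $F_t(y)=P\{Y^i_t\le y\}$, which is assumed to admit a continuous density $f_t$. For $n\ge1$ and integers $k$, set $$G_{n,t}(k)=\#\{i\in\{1,\dots,n\}:\ Y^i_t+c\tfrac{k}{n}\ge r\},$$ and define the random set $$\mathcal{K}_{n,t}=\{0\le k\le n:\ G_{n,t}(k)=k=G_{n,t}(k-1)\}$$ (the values $k$ for which $k/n$ satisfies the $n$-player equilibrium conditions at time $t$). *)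

(* Defs.v *)
From HB Require Import structures.
From mathcomp Require Import all_boot all_order all_algebra finmap.
From mathcomp Require Import all_classical all_reals all_analysis.

Set Implicit Arguments.
Unset Strict Implicit.
Unset Printing Implicit Defensive.

Import Order.TTheory GRing.Theory Num.Theory.
Import numFieldNormedType.Exports.

Local Open Scope classical_set_scope.
Local Open Scope ring_scope.

Section iid.
Context d (T : measurableType d) (R : realType) (P : probability T R).

Definition mutually_independent (X : nat -> {RV P >-> R}) : Prop :=
  forall (J : {fset nat}) (A : nat -> set R),
    (forall j, j \in J -> measurable (A j)) ->
    P (\bigcap_(j in [set` J]) (X j @^-1` A j)) =
    (\prod_(j <- J) P (X j @^-1` A j))%E.

Definition identically_distributed (X : nat -> {RV P >-> R}) : Prop :=
  forall (i j : nat) (A : set R), measurable A ->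
    distribution P (X i) A = distribution P (X j) A.

Definition iid (X : nat -> {RV P >-> R}) : Prop :=
  mutually_independent X /\ identically_distributed X.

(* Continuity is required on [0, +oo[ only, the range of the signals, so that
   laws such as the exponential one, whose density jumps at 0 when extended by
   0 to the negative reals, are covered; a density continuous on the whole line
   is a special case. *)
Definition continuous_density (X : {RV P >-> R}) (f : R -> R) : Prop :=
  [/\ measurable_fun [set: R] f,
      forall y, 0 <= f y,
      forall y, cdf X y = (\int[lebesgue_measure]_(z in `]-oo, y]) (f z)%:E)%E
    & {within `[0, +oo[, continuous f}].

End iid.

Section equilibria.
Context (R : realType).

(* [y i] is a realization of the signal of player [i.+1] (players are numbered
   from 0 here). *)
Definition stopped_count (r c : R) (y : nat -> R) (n : nat) (k : int) : nat :=
  #|[pred i : 'I_n | r <= y i + c * (k%:~R / n%:R)]|.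

(* [k] is an [int] since [k = 0] involves the value of the count at [-1]. *)
Definition equilibria (r c : R) (y : nat -> R) (n : nat) : set int :=
  [set k : int | [/\ 0 <= k, k <= n%:Z,
     (stopped_count r c y n k)%:Z = k &
     (stopped_count r c y n (k - 1))%:Z = k]].

End equilibria.

Section bound.
Context (R : realType).

Definition std_normal_cdf (x : R) : R :=
  fine (normal_prob (0 : R) 1 `]-oo, x]).

Definition a0 (alpha : R) : R := 1 - alpha + ln alpha.

Definition L (alpha : R) : R :=
  expR (- alpha) /
  ((alpha - 1) *
   (1 + 2 * Num.sqrt (2 / `|a0 alpha|) *
        (1 - std_normal_cdf (Num.sqrt (2 * `|a0 alpha|))))).

End bound.

(* Main.v *)
Require Import Defs.
From HB Require Import structures.
From mathcomp Require Import all_boot all_order all_algebra finmap.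
From mathcomp Require Import all_classical all_reals all_analysis.
From mathcomp Require Import measurable_realfun.
From mathcomp Require Import ring lra.

(** The indices in [equilibria] are counted by the second moment method.

Let [p a] be the probability that a signal is at least [r - c a], that is, that
a player stops when a fraction [a] of the players does. By independence, [k] is
an equilibrium with probability [visit_prob p n k = 'C(n, k) p((k - 1) / n) ^ k
(1 - p(k / n)) ^ (n - k)]. The hypotheses say that [p x = x] and that [p] has
slope [alpha > 1] at [x].

Let [Z] be the number of equilibria in a small window around [x].

- First moment. Since [p a - a] has slope [alpha - 1] at [x], a local limit
  theorem shows that [visit_prob p n k] is close to [exp (- alpha)] times a
  Gaussian weight in [(alpha - 1) (k - n x) / sqrt n]. Summing over [k] gives
  [E Z >= (1 - kap) exp (- alpha) / (alpha - 1)] for [n] large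
  ([expected_visits_ge]). Only lower bounds occur, and the one on the binomial
  coefficients rests on Stirling's constant being at most [sqrt (2 pi)]
  ([log_stirling_const_le_gauss]).

- Second moment. Given an equilibrium at [k], the other [n - k] signals are
  independent and below a threshold; [k + j] is also an equilibrium with a
  probability of at most [revisit_weight (- a0 alpha) j], essentially the
  Poisson probability [exp (- alpha j) (alpha (j - 1)) ^ j / j!]
  ([pair_prob_le]), and [0] if [j = 1]. By Stirling's formula the sum over [j
  >= 2] is below the integral of [exp (- |a0| u) / sqrt (2 pi u)] over [u >=
  1], which the substitution [y = sqrt (2 |a0| u)] turns into the normal tail
  [I] that appears in [L] ([gauss_tail_sum]). Hence [E Z ^ 2 <= (1 + 2 I) E Z].

- Therefore [P (Z > 0) >= E Z / (1 + 2 I) >= (1 - kap) L alpha]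
  ([second_moment_union]), in every small enough window around [x] and for
  every [kap > 0], once [n] is large. *)

Set Implicit Arguments.
Unset Strict Implicit.
Unset Printing Implicit Defensive.

Import Order.TTheory GRing.Theory Num.Theory.
Import numFieldNormedType.Exports.

Local Open Scope classical_set_scope.
Local Open Scope ring_scope.


(** * Bounds on the logarithm *)

Section log_bounds.
Context {R : realType}.
Implicit Types t : R.

Lemma derive_nonneg_ge0 (f df : R -> R) (a t : R) :
  (forall s : R, a <= s -> is_derive s 1 f (df s)) ->
  (forall s, a <= s -> 0 <= df s) -> f a = 0 -> a <= t -> 0 <= f t.
Proof.
move=> fd df0 f0 t0; rewrite -f0.
apply: (@ger0_derive1_ndecry _ f a) => //.
- move=> s; rewrite in_itv/= andbT => /ltW s0; exact: (@ex_derive _ _ _ _ _ _ _ (fd s s0)).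
- move=> s; rewrite in_itv/= andbT => /ltW s0.
  by rewrite derive1E (@derive_val _ _ _ _ _ _ _ (fd s s0)) df0.
- apply: continuous_in_subspaceT => s; rewrite inE/= in_itv/= andbT => s0.
  apply: differentiable_continuous; apply/derivable1_diffP.
  exact: (@ex_derive _ _ _ _ _ _ _ (fd s s0)).
Qed.

(** This bound and the next one are exact to second order at [1]: that is the
precision that decides the sign of the increments of [log_stirling] below. *)
Lemma ln_ge_pade t : 1 <= t -> (t - 1) * 2 / (1 + t) <= ln t.
Proof.
move=> t1; rewrite ler_pdivrMr; last lra.
rewrite -subr_ge0.
pose f s : R := ln s * (1 + s) - (s - 1) * 2.
pose df s : R := ln s + s^-1 - 1.
apply: (@derive_nonneg_ge0 f df 1) => //.
- move=> s s1; rewrite /f /df.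
  have s0 : 0 < s by lra.
  have dl := is_derive1_ln s0.
  have s2 : s != 0 by exact: lt0r_neq0.
  apply: is_derive_eq.
  by rewrite /GRing.scale/=; field.
- move=> s s1; rewrite /df.
  have s0 : 0 < s by lra.
  have := @le_ln1Dx R (s^-1 - 1); rewrite addrCA subrr addr0 lnV ?posrE// => H.
  have : 0 < s^-1 by rewrite invr_gt0.
  by move: H; move: s^-1 (ln s) => u v H u0; have := H ltac:(lra); lra.
- by rewrite /f ln1 subrr !mul0r subrr.
Qed.

Lemma ln_le_mean t : 1 <= t -> ln t <= (t - t^-1) / 2.
Proof.
move=> t1; have t0 : 0 < t by lra.
rewrite -(ler_pM2r t0) -subr_ge0.
have -> : (t - t^-1) / 2 * t = (t ^+ 2 - 1) / 2 by field; exact: lt0r_neq0.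
pose f s : R := (s ^+ 2 - 1) * 2^-1 - ln s * s.
pose df s : R := s - 1 - ln s.
apply: (@derive_nonneg_ge0 f df 1) => //.
- move=> s s1; rewrite /f /df.
  have s0 : 0 < s by lra.
  have dl := is_derive1_ln s0.
  have s2 : s != 0 by apply: lt0r_neq0; lra.
  apply: is_derive_eq.
  by rewrite /GRing.scale/=; field.
- move=> s s1; rewrite /df.
  by have := @le_ln1Dx R (s - 1) ltac:(lra); rewrite addrCA subrr addr0; lra.
- by rewrite /f ln1 expr1n subrr !mul0r subrr.
Qed.

(** One of the two previous bounds applies, according to the sign of [t]. *)
Lemma ln1D_ge_quad t : `|t| <= 2^-1 -> t - t ^+ 2 / 2 - `|t| ^+ 3 <= ln (1 + t).
Proof.
have [t0|t0] := leP 0 t.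
  rewrite ger0_norm// => t1.
  have := @ln_ge_pade (1 + t) ltac:(lra).
  apply: le_trans; rewrite ler_pdivlMr; last lra.
  have := exprn_ge0 3 t0; have := exprn_ge0 4 t0; lra.
rewrite ltr0_norm// => t1.
have v0 : 0 < 1 + t by lra.
have := @ln_le_mean (1 + t)^-1.
rewrite invrK lnV ?posrE// => /(_ _)/wrap[]; first by rewrite invf_ge1//; lra.
set u := ln _; move: (u) => {}u.
rewrite -(ler_pM2r v0).
have -> : ((1 + t)^-1 - (1 + t)) / 2 * (1 + t) = (1 - (1 + t) ^+ 2) / 2.
  by field; exact: lt0r_neq0.
move=> H; rewrite -(ler_pM2r v0).
have : 0 <= (- t) ^+ 3 * (1 + 2 * t) by rewrite mulr_ge0 ?exprn_ge0//; lra.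
by move: H; lra.
Qed.

End log_bounds.

(** * Stirling's formula, with an upper bound on its constant *)

Section stirling.
Context {R : realType}.
Implicit Types n m : nat.

(** The logarithm of [n! / (n ^ (n + 1/2) e ^ - n)], whose limit is the
logarithm of Stirling's constant. *)
Definition log_stirling n : R :=
  ln n`!%:R + n%:R - (n%:R + 2^-1) * ln n%:R.

Let ln_nat_succ n : (0 < n)%N ->
  ln (n.+1%:R : R) = ln n%:R + ln (1 + n%:R^-1).
Proof.
move=> n0; have n0' : (0 : R) < n%:R by rewrite ltr0n.
have n1 : (0 : R) < 1 + n%:R^-1 by rewrite addr_gt0// invr_gt0.
rewrite -lnM ?posrE//.
by rewrite mulrDr mulr1 divff ?lt0r_neq0// -natr1.
Qed.

Lemma log_stirling_diff n : (0 < n)%N ->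
  log_stirling n - log_stirling n.+1 =
  (n%:R + 2^-1) * ln (1 + n%:R^-1) - 1.
Proof.
move=> n0; rewrite /log_stirling factS natrM lnM ?posrE ?ltr0n ?fact_gt0//.
by rewrite ln_nat_succ// -natr1; ring.
Qed.

Lemma log_stirling_decr n : (0 < n)%N -> log_stirling n.+1 <= log_stirling n.
Proof.
move=> n0; rewrite -subr_ge0 log_stirling_diff//.
have n0' : (0 : R) < n%:R by rewrite ltr0n.
have := @ln_ge_pade R (1 + n%:R^-1).
rewrite lerDl invr_ge0 ltW// => /(_ isT).
have -> : (1 + n%:R^-1 - 1) * 2 / (1 + (1 + n%:R^-1)) = (n%:R + 2^-1 : R)^-1.
  field; rewrite (lt0r_neq0 n0') andbT lt0r_neq0//; lra.
have n1 : 0 < n%:R + 2^-1 :> R by lra.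
rewrite -(ler_pM2l n1) divff ?lt0r_neq0//. lra.
Qed.

(** The decrements of [log_stirling] are at most [1 / (4 n (n + 1))], a
telescoping series: hence the limit is finite. *)
Lemma log_stirling_incr n : (0 < n)%N ->
  log_stirling n - (4 * n%:R)^-1 <= log_stirling n.+1 - (4 * n.+1%:R)^-1.
Proof.
move=> n0.
have swap (a b c d : R) : a - b <= c - d -> a - c <= b - d by lra.
apply: swap.
rewrite log_stirling_diff//.
have n0' : (0 : R) < n%:R by rewrite ltr0n.
have := @ln_le_mean R (1 + n%:R^-1).
rewrite lerDl invr_ge0 ltW// => /(_ isT).
have n1 : 0 < n%:R + 2^-1 :> R by lra.
rewrite -(ler_pM2l n1) => H.
apply: (@le_trans _ _ ((n%:R + 2^-1) *
        ((1 + n%:R^-1 - (1 + n%:R^-1)^-1) / 2) - 1)); first by rewrite lerB.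
rewrite -natr1 le_eqVlt; apply/orP; left; apply/eqP; field.
by rewrite (lt0r_neq0 n0') andbT lt0r_neq0//; lra.
Qed.

Lemma log_stirling_ge n : (0 < n)%N -> 3 / 4 <= log_stirling n.
Proof.
move=> n0; suff : 3 / 4 <= log_stirling n - (4 * n%:R)^-1.
  by move=> /le_trans; apply; rewrite gerBl invr_ge0 mulr_ge0.
elim: n n0 => // -[_ _|n ih _].
  by rewrite /log_stirling factS fact0 ln1; lra.
exact: le_trans (ih isT) (log_stirling_incr _).
Qed.

Lemma log_stirling_noninc : {in [pred n | (0 < n)%N] &,
  {homo log_stirling : m n / (m <= n)%N >-> n <= m}}.
Proof.
move=> m n; rewrite !inE => m0 _ /subnK <-.
elim: (n - m)%N => // k ih; rewrite addSn.
by apply: le_trans ih; apply: log_stirling_decr; rewrite ltn_addl.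
Qed.


(** Since [4 t (1 - t) = 1 - (2 t - 1) ^ 2 <= exp (- (2 t - 1) ^ 2)]. *)
Lemma beta_fun_le_gauss m : (0 < m)%N ->
  beta_fun m.+1 m.+1 <= 4 ^- m * Num.sqrt (pi / (4 * m%:R)) :> R.
Proof.
move=> m0; have m0' : (0 : R) < m%:R by rewrite ltr0n.
pose s : R := (Num.sqrt (8 * m%:R))^-1.
have s2 : s ^+ 2 = (8 * m%:R)^-1.
  by rewrite exprVn sqr_sqrtr// mulr_ge0// ltW.
have s0 : s != 0 by rewrite invr_eq0 sqrtr_eq0 -ltNge mulr_gt0.
have peakE : (normal_peak s)^-1 = Num.sqrt (pi / (4 * m%:R)).
  rewrite /normal_peak invrK s2; congr Num.sqrt; rewrite -mulr_natr; field.
  exact: lt0r_neq0.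
rewrite -peakE -lee_fin EFin_beta_fun.
have -> : (4 ^- m / normal_peak s)%:E = (\int[lebesgue_measure]_z
    ((4 ^- m / normal_peak s)%:E * (normal_pdf 2^-1 s z)%:E))%E.
  rewrite integralZl//; last exact: integrable_normal_pdf.
  by rewrite integral_normal_pdf mule1.
have c0 : 0 <= 4 ^- m / normal_peak s.
  by rewrite divr_ge0 ?normal_peak_ge0// invr_ge0 exprn_ge0.
apply: ge0_le_integral => //.
- move=> z _; rewrite lee_fin; apply: restrict_ge0 => //= t t01.
  by rewrite XMonemX_ge0.
- exact: measurable_int (@integrable_XMonemX_restrict R m.+1 m.+1).
- apply/measurable_EFinP; apply: measurable_funM => //.
  exact: measurable_normal_pdf.
move=> z _; rewrite -EFinM lee_fin patchE; case: ifPn => [|_]; last first.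
  by rewrite mulr_ge0// normal_pdf_ge0.
rewrite inE/= in_itv/= => /andP[z0 z1].
rewrite normal_pdfE// mulrA divfK; last by rewrite lt0r_neq0// normal_peak_gt0.
rewrite /normal_fun /XMonemX/= -exprMn [leRHS]mulrC ler_pdivlMr; last by rewrite exprn_gt0.
rewrite -exprMn s2.
have -> : - (z - 2^-1) ^+ 2 / ((8 * m%:R)^-1 *+ 2) = - (2 * z - 1) ^+ 2 * m%:R.
  field; exact: lt0r_neq0.
rewrite expRM_natr; apply: lerXn2r.
- by rewrite nnegrE !mulr_ge0// subr_ge0.
- by rewrite nnegrE expR_ge0.
apply: le_trans (expR_ge1Dx _).
by rewrite /unstable.onem; lra.
Qed.


Lemma ln_sqrt (y : R) : 0 < y -> ln (Num.sqrt y) = ln y / 2.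
Proof.
move=> y0; have s0 : 0 < Num.sqrt y by rewrite sqrtr_gt0.
rewrite -{2}[y]sqr_sqrtr ?ltW// lnXn// mulr2n; lra.
Qed.

(** The left-hand side is, up to elementary terms, the logarithm of [m! ^ 2 /
(2 m)!], which the beta integral of [t ^ m (1 - t) ^ m] expresses; the
integrand being below a Gaussian, [sqrt (2 pi)] comes from the normalization of
the normal density. *)
Lemma log_stirling_central m : (0 < m)%N ->
  2 * log_stirling m - log_stirling m.*2 <= ln (Num.sqrt (2 * pi)) + m%:R^-1.
Proof.
move=> m0; have m0' : (0 : R) < m%:R by rewrite ltr0n.
have := beta_fun_le_gauss m0; rewrite beta_fun_fact addnn.
have f0 k : (0 : R) < k`!%:R by rewrite ltr0n fact_gt0.
have p0 := @pi_gt0 R.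
rewrite -ler_ln ?posrE; last 2 first.
- by rewrite divr_gt0// ltr0n ?muln_gt0 ?fact_gt0.
- by rewrite mulr_gt0 ?invr_gt0 ?exprn_gt0 ?sqrtr_gt0 ?divr_gt0 ?mulr_gt0.
rewrite ln_div ?posrE// ?ltr0n ?muln_gt0 ?fact_gt0//.
rewrite lnM ?posrE ?sqrtr_gt0 ?divr_gt0 ?mulr_gt0 ?invr_gt0 ?exprn_gt0//.
rewrite !ln_sqrt ?divr_gt0 ?mulr_gt0//.
rewrite [ln (4 ^- m)]lnV ?posrE ?exprn_gt0// [ln (4 ^+ m)]lnXn//.
rewrite ln_div ?posrE ?mulr_gt0//.
rewrite factS !natrM !lnM ?posrE ?mulr_gt0//.
have -> : 4 = 2 * 2 :> R by ring.
rewrite lnM ?posrE//.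
rewrite /log_stirling -natr1 -mul2n natrM lnM ?posrE//.
rewrite -[(ln 2 + ln 2) *+ m]mulr_natr.
have : ln (2 * m%:R + 1) <= ln 2 + ln m%:R + m%:R^-1 / 2 :> R.
  have -> : 2 * m%:R + 1 = 2 * m%:R * (1 + m%:R^-1 / 2) :> R.
    by field; exact: lt0r_neq0.
  have w0 : 0 < m%:R^-1 / 2 :> R by rewrite divr_gt0 ?invr_gt0.
  have w1 : 0 < 1 + m%:R^-1 / 2 :> R by rewrite addr_gt0.
  rewrite !lnM ?posrE ?mulr_gt0//.
  by rewrite lerD2l le_ln1Dx// (lt_trans _ w0)// ltrN10.
have i0 : 0 < m%:R^-1 :> R by rewrite invr_gt0.
move: (m%:R^-1) i0 => u u0.
move: (ln pi) (ln (2 * m%:R + 1)) (ln m%:R) (ln 2) (ln m`!%:R) (ln (2 * m)`!%:R).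
move: (m%:R : R) => v a b c d e f; lra.
Qed.

Definition log_stirling_const : R := limn (fun n => log_stirling n.+1).

Let nincr_log_stirlingS : nonincreasing_seq (fun n => log_stirling n.+1).
Proof. by move=> m n mn; apply: log_stirling_noninc; rewrite ?inE. Qed.

Lemma cvg_log_stirling : log_stirling n @[n --> \oo] --> log_stirling_const.
Proof.
rewrite -cvg_shiftS; apply: nonincreasing_is_cvgn => //.
by exists (3 / 4) => _ [n _ <-]; exact: log_stirling_ge.
Qed.

(** The left-hand side of [log_stirling_central] tends to the constant itself.
This upper bound is what turns Stirling's formula into a sharp lower bound on
binomial coefficients. *)
Lemma log_stirling_const_le_gauss :
  log_stirling_const <= ln (Num.sqrt (2 * pi)).
Proof.
have c2 : (2 * log_stirling n.+1 - log_stirling n.+1.*2 : R) @[n --> \oo] -->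
    2 * log_stirling_const - log_stirling_const.
  apply: cvgB.
    by apply: cvgMr; rewrite (cvg_shiftS log_stirling); exact: cvg_log_stirling.
  have d : n.+1.*2 @[n --> \oo] --> \oo.
    apply/cvgnyPge => N; exists N => // n /= Nn.
    by rewrite -addnn addSn ltnW// ltnS (leq_trans Nn)// leq_addr.
  exact: (cvg_comp _ _ d cvg_log_stirling).
have ci : (ln (Num.sqrt (2 * pi)) + n.+1%:R^-1 : R) @[n --> \oo] --> ln (Num.sqrt (2 * pi)) + 0.
  by apply: cvgD; [exact: cvg_cst | exact: cvg_harmonic].
have -> : log_stirling_const = 2 * log_stirling_const - log_stirling_const by ring.
rewrite -[leRHS]addr0; apply: (ler_cvg_to c2 ci).
by apply: nearW => n; exact: log_stirling_central.
Qed.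

End stirling.

(** * The normal distribution function *)

Section normal_cdf.
Context {R : realType}.
Local Notation mu := (@lebesgue_measure R).
Implicit Types (g : R -> R) (u v s b : R).

Lemma integral_itvoc_ge g u v b : measurable_fun setT g -> u <= v -> 0 <= b ->
  (forall z, u < z <= v -> b <= g z) ->
  ((b * (v - u))%:E <= \int[mu]_(z in `]u, v]) (g z)%:E)%E.
Proof.
move=> mg uv b0 bg.
have -> : (b * (v - u))%:E = (\int[mu]_(z in `]u, v]) (cst b%:E z))%E.
  rewrite integral_cst//= lebesgue_measure_itv/= lte_fin EFinM.
  by case: ltP => // vu; rewrite (le_anti (introT andP (conj uv vu))) subrr.
apply: ge0_le_integral => //.
by apply/measurable_EFinP; exact: measurable_funS mg.
Qed.

Lemma integral_itvoc_le g u v b : measurable_fun setT g -> u <= v ->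
  (forall z, 0 <= g z) -> (forall z, u < z <= v -> g z <= b) ->
  (\int[mu]_(z in `]u, v]) (g z)%:E <= (b * (v - u))%:E)%E.
Proof.
move=> mg uv g0 gb.
have -> : (b * (v - u))%:E = (\int[mu]_(z in `]u, v]) (cst b%:E z))%E.
  rewrite integral_cst//= lebesgue_measure_itv/= lte_fin EFinM.
  by case: ltP => // vu; rewrite (le_anti (introT andP (conj uv vu))) subrr.
apply: ge0_le_integral => //.
- by move=> z _; rewrite lee_fin.
by apply/measurable_EFinP; exact: measurable_funS mg.
Qed.

Definition normal_cdf s u : R := fine (normal_prob 0 s `]-oo, u]).

Lemma normal_cdfB s u v : u <= v ->
  (normal_cdf s v - normal_cdf s u)%:E = normal_prob 0 s `]u, v].
Proof.
move=> uv; rewrite /normal_cdf.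
have -> : `]-oo, v]%classic = `]-oo, u] `|` `]u, v].
  by rewrite -itv_bndbnd_setU// bnd_simp.
rewrite measureU//; last first.
  apply/seteqP; split => z //=; rewrite !in_itv/= => -[zu /andP[/lt_le_trans/(_ zu)]].
  by rewrite ltxx.
rewrite fineD ?fin_num_measure// addrAC subrr add0r fineK// fin_num_measure//.
Qed.

Lemma normal_cdf_nd s u v : u <= v -> normal_cdf s u <= normal_cdf s v.
Proof. by move=> uv; rewrite -subr_ge0 -lee_fin normal_cdfB. Qed.

Lemma normal_cdf_le1 s u : normal_cdf s u <= 1.
Proof.
rewrite -lee_fin fineK ?fin_num_measure//; exact: probability_le1.
Qed.

Lemma normal_cdf_ge s u v b : u <= v -> 0 <= b ->
  (forall z, u < z <= v -> b <= normal_pdf 0 s z) ->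
  b * (v - u) <= normal_cdf s v - normal_cdf s u.
Proof.
move=> uv b0 bg; rewrite -lee_fin normal_cdfB//.
by apply: integral_itvoc_ge => //; exact: measurable_normal_pdf.
Qed.

Lemma normal_cdf_le s u v b : u <= v ->
  (forall z, u < z <= v -> normal_pdf 0 s z <= b) ->
  normal_cdf s v - normal_cdf s u <= b * (v - u).
Proof.
move=> uv bg; rewrite -lee_fin normal_cdfB//.
apply: integral_itvoc_le => //; first exact: measurable_normal_pdf.
by move=> z; exact: normal_pdf_ge0.
Qed.

Lemma normal_cdf_window s (e : R) : 0 < e ->
  exists2 M : R, 0 < M & 1 - e <= normal_cdf s M - normal_cdf s (- M).
Proof.
move=> e0.
have : normal_prob 0 s `](- n%:R), n%:R] @[n --> \oo] --> normal_prob 0 s setT.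
  have <- : \bigcup_n `](- n%:R : R), n%:R]%classic = setT.
    rewrite -subTset => z _/=; exists (Num.truncn `|z|).+1 => //=.
    have := truncnS_gt `|z|; rewrite in_itv/= ltr_norml => /andP[-> /ltW ->].
    by [].
  apply: nondecreasing_cvg_mu => //; first exact: bigcup_measurable.
  move=> n m nm; apply/subsetPset => z/=; rewrite !in_itv/= => /andP[a b].
  by rewrite (le_lt_trans _ a) ?lerN2 ?ler_nat//= (le_trans b)// ler_nat.
rewrite probability_setT => /fine_cvgP[_ /cvgrPdist_le/(_ e e0)[N _ HN]].
exists N.+1%:R => //; have := HN N.+1 (leqnSn _).
have NN : - N.+1%:R <= N.+1%:R :> R by have := ler0n R N.+1; lra.
rewrite /= -normal_cdfB//= ler_norml => /andP[_]; lra.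
Qed.


(** On the image of the cell [[w, j]] under [u |-> sqrt (2 a u)], the density
is least at the right end, where it is [exp (- a j) / sqrt (2 pi)], and the
length of the image is [sqrt (2 a) (j - w) / (sqrt j + sqrt w)]. *)
Lemma normal_cdf1_cell (a w j : R) : 0 < a -> 0 <= w -> w + 6 / 7 <= j ->
  expR (- (a * j)) / Num.sqrt j * (6 / 7) <=
  Num.sqrt (2 * pi) * Num.sqrt (2 / a) *
  (normal_cdf 1 (Num.sqrt (2 * a * j)) - normal_cdf 1 (Num.sqrt (2 * a * w))).
Proof.
move=> a0 w0 wj; have j0 : 0 < j by lra.
have p0 := @pi_gt0 R.
have sj0 : 0 < Num.sqrt j by rewrite sqrtr_gt0.
have sw0 : 0 <= Num.sqrt w by rewrite sqrtr_ge0.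
have swj : Num.sqrt w <= Num.sqrt j by rewrite ler_sqrt//; lra.
have s2p : 0 < Num.sqrt (2 * pi :> R) by rewrite sqrtr_gt0 mulr_gt0.
have s2a : 0 < Num.sqrt (2 / a) by rewrite sqrtr_gt0 divr_gt0.
have pdfE (z : R) : normal_pdf 0 1 z = expR (- z ^+ 2 / 2) / Num.sqrt (2 * pi).
  rewrite normal_pdfE ?oner_neq0// /normal_peak /normal_fun subr0 expr1n mul1r mulrC.
  by rewrite mulr_natl.
have uv : Num.sqrt (2 * a * w) <= Num.sqrt (2 * a * j).
  by rewrite ler_wsqrtr// ler_pM2l ?mulr_gt0//; lra.
have := @normal_cdf_ge 1 _ _ (expR (- (a * j)) / Num.sqrt (2 * pi)) uv.
rewrite divr_ge0 ?expR_ge0 ?sqrtr_ge0// => /(_ isT)/(_ _)/wrap[].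
  move=> z /andP[z0 z1]; rewrite pdfE ler_pM2r ?invr_gt0// ler_expR.
  have z00 : 0 <= z by rewrite (le_trans _ (ltW z0))// sqrtr_ge0.
  have z2 : z ^+ 2 <= Num.sqrt (2 * a * j) ^+ 2.
    by apply: lerXn2r; rewrite ?nnegrE ?sqrtr_ge0.
  have aj0 : 0 <= 2 * a * j by rewrite !mulr_ge0 ?ltW.
  by rewrite sqr_sqrtr// in z2; lra.
move=> H; rewrite -(ler_pM2l (mulr_gt0 s2p s2a)) in H; apply: le_trans H.
have ta0 : 0 <= 2 * a by rewrite mulr_ge0// ltW.
rewrite !(sqrtrM _ ta0).
have E2 : Num.sqrt (2 / a) * Num.sqrt (2 * a) = 2.
  rewrite -sqrtrM ?divr_ge0 ?ltW//.
  have -> : 2 / a * (2 * a) = 2 ^+ 2 by field; exact: lt0r_neq0.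
  by rewrite sqrtr_sqr ger0_norm.
rewrite -mulrBr.
set E := expR _; have E0 : 0 <= E by exact: expR_ge0.
have -> : Num.sqrt (2 * pi) * Num.sqrt (2 / a) *
    (E / Num.sqrt (2 * pi) * (Num.sqrt (2 * a) * (Num.sqrt j - Num.sqrt w))) =
    E * ((Num.sqrt (2 / a) * Num.sqrt (2 * a)) * (Num.sqrt j - Num.sqrt w)).
  by field; exact: lt0r_neq0.
rewrite E2 -mulrA ler_wpM2l// mulrC ler_pdivrMr//.
have jE : Num.sqrt j ^+ 2 = j by rewrite sqr_sqrtr// ltW.
have wE : Num.sqrt w ^+ 2 = w by rewrite sqr_sqrtr.
have := mulr_ge0 (_ : 0 <= Num.sqrt j - Num.sqrt w) (_ : 0 <= Num.sqrt j - Num.sqrt w).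
rewrite subr_ge0 => /(_ swj swj); move: jE wE wj; rewrite !expr2.
by move: (Num.sqrt j) (Num.sqrt w) => p q; lra.
Qed.

(** The right-hand side is the integral of [exp (- a u) / sqrt (2 pi u)] over
[u >= 1], after the substitution [y = sqrt (2 a u)]. With [b = 7 a / 8], the
sum is compared cell by cell on [[j - 6/7, j]]: the first cell starts at [8/7],
and [b * (8/7) = a]. The constants lost, [7/6] for the shorter cells and [sqrt
(8/7)] for the change of rate, are paid by [exp (- 7/4)] being much less than
[1 / sqrt (2 pi)]. *)
Lemma gauss_tail_sum (a : R) (J : nat) : 0 < a ->
  \sum_(2 <= j < J) expR (- (7 / 4)) * (expR (- (7 / 8 * a * j%:R)) / Num.sqrt j%:R) <=
  Num.sqrt (2 / a) * (1 - normal_cdf 1 (Num.sqrt (2 * a))).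
Proof.
move=> a0; set b := 7 / 8 * a; have b0 : 0 < b by rewrite /b; lra.
have p0 := @pi_gt0 R.
have s2p : 0 < Num.sqrt (2 * pi :> R) by rewrite sqrtr_gt0 mulr_gt0.
have s2b : 0 < Num.sqrt (2 / b) by rewrite sqrtr_gt0 divr_gt0.
set C := 7 / 6 * (Num.sqrt (2 * pi) * Num.sqrt (2 / b)).
have C0 : 0 < C by rewrite /C !mulr_gt0// divr_gt0.
have abE : 2 * b * (8 / 7) = 2 * a by rewrite /b; field.
have tele : \sum_(2 <= j < J.+2) (expR (- (b * j%:R)) / Num.sqrt j%:R) <=
    C * (normal_cdf 1 (Num.sqrt (2 * b * (J.+1%:R + 7^-1))) -
         normal_cdf 1 (Num.sqrt (2 * a))).
  elim: J => [|J ih].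
    rewrite big_geq//; apply: mulr_ge0; first exact: ltW.
    rewrite subr_ge0 normal_cdf_nd// ler_wsqrtr// -abE.
    by rewrite ler_pM2l ?mulr_gt0//; lra.
  rewrite big_nat_recr//=; apply: le_trans (lerD ih (lexx _)) _.
  have h1 : 0 <= J.+1%:R + 7^-1 :> R by rewrite addr_ge0.
  have h2 : J.+1%:R + 7^-1 + 6 / 7 <= J.+2%:R :> R by rewrite -(natr1 J.+1); lra.
  have := normal_cdf1_cell b0 h1 h2.
  have : normal_cdf 1 (Num.sqrt (2 * b * J.+2%:R)) <=
         normal_cdf 1 (Num.sqrt (2 * b * (J.+2%:R + 7^-1))).
    rewrite normal_cdf_nd// ler_wsqrtr// ler_pM2l ?mulr_gt0//; lra.
  rewrite -(ler_pM2l C0) /C.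
  move: (Num.sqrt (2 * pi) * Num.sqrt (2 / b)) => c.
  move: (normal_cdf 1 _) (normal_cdf 1 _) (normal_cdf 1 _) (normal_cdf 1 _).
  by move: (_ / Num.sqrt _) => p t1 t2 t3 t4; lra.
have le2 : \sum_(2 <= j < J) (expR (- (b * j%:R)) / Num.sqrt j%:R) <=
    \sum_(2 <= j < J.+2) (expR (- (b * j%:R)) / Num.sqrt j%:R).
  have t0 j : 0 <= expR (- (b * j%:R)) / Num.sqrt j%:R.
    by rewrite divr_ge0 ?expR_ge0 ?sqrtr_ge0.
  case: (leqP 2 J) => J2; last by rewrite big_geq ?sumr_ge0// ltnW.
  rewrite [leRHS](@big_cat_nat _ _ _ J)//=; last by rewrite ltnW// ltnW.
  by rewrite lerDl sumr_ge0.
rewrite -mulr_sumr; apply: le_trans (ler_wpM2l (expR_ge0 _) (le_trans le2 tele)) _.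
rewrite mulrA; apply: ler_pM.
- by rewrite mulr_ge0 ?expR_ge0 ?ltW.
- rewrite subr_ge0 normal_cdf_nd// ler_wsqrtr// -abE ler_pM2l ?mulr_gt0//.
  by have : 1 <= J.+1%:R :> R by [rewrite ler1n]; lra.
- have -> : Num.sqrt (2 / a) = Num.sqrt (2 / b) * Num.sqrt (7 / 8).
    rewrite -sqrtrM ?divr_ge0 ?ltW//; congr Num.sqrt.
    by rewrite /b; field; exact: lt0r_neq0.
  (* [exp (7/2) >= (3/2) ^ 7 > 8 * 14/9], from [exp (1/2) >= 3/2]; and [2 pi < 8] *)
  have e72 : (3 / 2) ^+ 7 <= expR (7 / 4) ^+ 2 :> R.
    have -> : expR (7 / 4) ^+ 2 = expR (2^-1) ^+ 7 :> R.
      by rewrite -!expRM_natl; congr expR; lra.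
    apply: lerXn2r; rewrite ?nnegrE ?expR_ge0//.
    by apply: le_trans (expR_ge1Dx _); lra.
  have : Num.sqrt (2 * pi) * (7 / 6) <= expR (7 / 4) * Num.sqrt (7 / 8) :> R.
    rewrite -(@ler_pXn2r _ 2)// ?nnegrE ?mulr_ge0 ?sqrtr_ge0 ?expR_ge0//.
    rewrite !exprMn !sqr_sqrtr ?mulr_ge0//; last exact: ltW.
    have := @pihalf_lt2 R; have : 0 <= pi :> R by exact: ltW.
    by move: e72; move: (expR (7 / 4) ^+ 2) => e; lra.
  move=> H; rewrite expRN [leLHS]mulrC ler_pdivrMr ?expR_gt0// /C.
  move: H; rewrite -(ler_pM2l s2b); move: (Num.sqrt (2 / b)) (Num.sqrt (2 * pi)).
  move: (expR (7 / 4)) (Num.sqrt (7 / 8)) => p q t z; lra.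
- by rewrite lerD2r normal_cdf_le1.
Qed.

End normal_cdf.

(** * Binomial coefficients and null sequences *)

Section binomial_log.
Context {R : realType}.

Lemma ln_binomial n k : (0 < k < n)%N ->
  ln ('C(n, k)%:R : R) = log_stirling n - log_stirling k - log_stirling (n - k)
    - ln n%:R / 2 - (k%:R + 2^-1) * ln (k%:R / n%:R)
    - ((n - k)%:R + 2^-1) * ln (1 - k%:R / n%:R).
Proof.
move=> /andP[k0 kn]; have n0 : (0 < n)%N by exact: leq_trans kn.
have nk0 : (0 < n - k)%N by rewrite subn_gt0.
have n0' : (0 : R) < n%:R by rewrite ltr0n.
have k0' : (0 : R) < k%:R by rewrite ltr0n.
have nk0' : (0 : R) < (n - k)%:R by rewrite ltr0n.
have f0 j : (0 : R) < j`!%:R by rewrite ltr0n fact_gt0.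
have -> : 1 - k%:R / n%:R = (n - k)%:R / n%:R :> R.
  by rewrite natrB ?(ltnW kn)//; field; exact: lt0r_neq0.
have -> : 'C(n, k)%:R = n`!%:R / (k`!%:R * (n - k)`!%:R) :> R.
  by rewrite -(bin_fact (ltnW kn)) !natrM mulfK// mulf_neq0 ?lt0r_neq0.
rewrite !ln_div ?posrE ?mulr_gt0// lnM ?posrE// /log_stirling.
have nkE : (n - k)%:R = n%:R - k%:R :> R by rewrite natrB// ltnW.
move: (ln n`!%:R) (ln k`!%:R) (ln (n - k)`!%:R) (ln n%:R) (ln k%:R) (ln (n - k)%:R).
by move=> A B C D E F; rewrite nkE; field.
Qed.

End binomial_log.

Section sequences.
Context {R : realType}.

Lemma bounded_mul_cvg0 (u e : nat -> R) (C : R) : (forall n, `|u n| <= C) ->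
  e n @[n --> \oo] --> 0 -> u n * e n @[n --> \oo] --> 0.
Proof.
move=> uC e0.
have C0 : 0 <= C by exact: le_trans (uC 0%N).
have Ce0 : C * `|e n| @[n --> \oo] --> 0.
  have : C * `|e n| @[n --> \oo] --> C * `|0 : R| by apply: cvgMr; exact: cvg_norm.
  by rewrite normr0 mulr0.
have NCe0 : - (C * `|e n|) @[n --> \oo] --> 0.
  by rewrite -[X in _ --> X]oppr0; exact: cvgN.
apply: (squeeze_cvgr _ NCe0 Ce0); apply: nearW => n.
by rewrite -ler_norml normrM ler_wpM2r.
Qed.

Lemma cvg_inv_sqrt_nat : (Num.sqrt n%:R)^-1 @[n --> \oo] --> (0 : R).
Proof.
rewrite -(cvg_shiftS (fun n => (Num.sqrt n%:R)^-1 : R)).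
have : Num.sqrt (n.+1%:R^-1) @[n --> \oo] --> Num.sqrt (0 : R).
  by apply: continuous_cvg; [exact: sqrt_continuous | exact: cvg_harmonic].
by rewrite sqrtr0; under eq_fun do rewrite sqrtrV//.
Qed.

End sequences.

(** * Strict derivatives *)

Section strict_derivative.
Context {R : realType}.

(** The increment is controlled between any two points near [x], as is needed
for the pairs [(k - 1) / n], [k / n] that both move with [n]. An integral whose
integrand is continuous at [x] has this property. *)
Definition strictly_derivable (p : R -> R) (x alpha : R) : Prop :=
  forall e, 0 < e -> exists2 eta, 0 < eta & forall a b,
    `|a - x| < eta -> `|b - x| < eta ->
    `|p b - p a - alpha * (b - a)| <= e * `|b - a|.

(** [s] is the scale at which the increment is observed: [n] for two neighbours
on the grid, [sqrt n] for the distance of the window to [x]. *)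
Lemma strictly_derivable_cvg p x alpha (y z s : nat -> R) (C : R) :
  strictly_derivable p x alpha ->
  y n @[n --> \oo] --> x -> z n @[n --> \oo] --> x ->
  (forall n, `|s n * (z n - y n)| <= C) ->
  s n * (p (z n) - p (y n) - alpha * (z n - y n)) @[n --> \oo] --> 0.
Proof.
move=> dp yx zx sC; apply/cvgr0Pnorm_le => e e0.
have C0 : 0 <= C by exact: le_trans (sC 0%N).
have C1 : 0 < C + 1 by exact: ltr_wpDl.
have [eta eta0 Heta] := dp (e / (C + 1)) (divr_gt0 e0 C1).
move/cvgrPdistC_lt : yx => /(_ eta eta0) yx.
move/cvgrPdistC_lt : zx => /(_ eta eta0) zx.
near=> n; rewrite normrM.
have yn : `|y n - x| < eta by near: n.
have zn : `|z n - x| < eta by near: n.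
have H := Heta _ _ yn zn.
apply: le_trans (ler_wpM2l (normr_ge0 _) H) _.
rewrite mulrCA -normrM.
apply: le_trans (ler_wpM2l _ (sC n)) _; first by rewrite divr_ge0 ?ltW.
rewrite mulrAC ler_pdivrMr// ler_pM2l//; lra.
Unshelve. all: by end_near. Qed.

End strict_derivative.

(** * Quadratic terms along bounded sequences *)

Section quadratic_limits.
Context {R : realType}.
Variables (B E a : nat -> R) (C x : R).
Hypotheses (BC : forall n, `|B n| <= C) (E0 : E n @[n --> \oo] --> 0)
  (ax : a n @[n --> \oo] --> x) (x0 : x != 0).

Let ainv : (a n)^-1 @[n --> \oo] --> x^-1.
Proof. exact: cvgV. Qed.

(** [B] need not converge: only differences have a limit. *)
Lemma perturbed_square_cvg0 :
  (B n + E n) ^+ 2 / a n - B n ^+ 2 / x @[n --> \oo] --> 0.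
Proof.
have C0 : 0 <= C by exact: le_trans (BC 0%N).
have -> : (fun n => (B n + E n) ^+ 2 / a n - B n ^+ 2 / x) =
  (fun n => (B n * E n * 2 + E n * E n) * (a n)^-1
            + B n ^+ 2 * ((a n)^-1 - x^-1)).
  by apply/funext => n; ring.
have -> : 0 = (0 * 2 + 0 * 0) * x^-1 + 0 :> R by ring.
have BE0 : B n * E n @[n --> \oo] --> 0 by exact: (bounded_mul_cvg0 BC).
apply: cvgD.
  by apply: cvgM => //; apply: cvgD; [apply: cvgM => //; exact: cvg_cst|exact: cvgM].
apply: (@bounded_mul_cvg0 _ _ _ (C ^+ 2)).
  by move=> n; rewrite normrX; apply: lerXn2r; rewrite ?nnegrE.
rewrite -(subrr x^-1); apply: cvgB => //; exact: cvg_cst.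
Qed.

Lemma small_mul_square_cvg0 (w : nat -> R) : w n @[n --> \oo] --> 0 ->
  `|w n| * ((B n + E n) ^+ 2 / a n) @[n --> \oo] --> 0.
Proof.
move=> w0; have nw0 : `|w n| @[n --> \oo] --> 0.
  by rewrite -[X in _ --> X](@normr0 _ R); exact: cvg_norm.
have C0 : 0 <= C by exact: le_trans (BC 0%N).
have -> : (fun n => `|w n| * ((B n + E n) ^+ 2 / a n)) =
  (fun n => `|w n| * ((B n + E n) ^+ 2 / a n - B n ^+ 2 / x)
    + B n ^+ 2 / x * `|w n|).
  by apply/funext => n; ring.
have -> : 0 = 0 * 0 + 0 :> R by ring.
apply: cvgD; first by apply: cvgM => //; exact: perturbed_square_cvg0.
apply: (@bounded_mul_cvg0 _ _ _ (C ^+ 2 / `|x|)) => // n.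
rewrite normrM normfV normrX ler_wpM2r ?invr_ge0//.
by apply: lerXn2r; rewrite ?nnegrE.
Qed.

End quadratic_limits.

(** * The probability of being an equilibrium, and its Gaussian value *)

Section visit_probability.
Context {R : realType}.

(** The probability that [k] is an equilibrium among [n] players (a visit of
[k] by the random set), when each of them stops with probability [p a] if a
fraction [a] does: [k] players already stop at the level [(k - 1) / n], the
others do not stop even at the level [k / n]. *)
Definition visit_prob (p : R -> R) n k : R :=
  'C(n, k)%:R * p ((k%:R - 1) / n%:R) ^+ k * (1 - p (k%:R / n%:R)) ^+ (n - k).

(** The Gaussian value of [visit_prob p n k] when [p] has slope [alpha] at its
fixed point [x], reduced by a factor [exp (- e)]. The factor [exp (- alpha)] is
the limit of the probability that none of [n] signals falls between two
consecutive thresholds. *)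
Definition gauss_visit (x alpha e : R) n k : R :=
  expR (- alpha - e
        - ((alpha - 1) * (k%:R - n%:R * x) / Num.sqrt n%:R) ^+ 2
           / (2 * (x * (1 - x))))
  / Num.sqrt (2 * pi * (x * (1 - x)) * n%:R).

(** Stirling's formula absorbs the binomial coefficient into the powers, which
become relative to [a = k / n]; the linear terms of the two logarithms will
cancel. *)
Lemma ln_visit_prob (p : R -> R) n k : (0 < k < n)%N ->
  0 < p ((k%:R - 1) / n%:R) -> 0 < 1 - p (k%:R / n%:R) ->
  let a := k%:R / n%:R in
  0 < visit_prob p n k /\
  ln (visit_prob p n k) = log_stirling n - log_stirling k - log_stirling (n - k)
    - ln n%:R / 2 - ln a / 2 - ln (1 - a) / 2
    + n%:R * (a * ln (1 + (p ((k%:R - 1) / n%:R) - a) / a))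
    + n%:R * ((1 - a) * ln (1 - (p a - a) / (1 - a))).
Proof.
move=> /[dup] kn0n /andP[k0 kn] p0 q0; set P := p _ in p0 *; move=> a.
have n0' : (0 : R) < n%:R by rewrite ltr0n (leq_trans _ kn).
have k0' : (0 : R) < k%:R by rewrite ltr0n.
have a0 : 0 < a by rewrite divr_gt0.
have nkE : (n - k)%:R = n%:R - k%:R :> R by rewrite natrB// ltnW.
have aE : k%:R = n%:R * a :> R by rewrite /a; field; exact: lt0r_neq0.
have a1 : 0 < 1 - a.
  by rewrite subr_gt0 ltr_pdivrMr// mul1r ltr_nat.
have b0 : (0 : R) < 'C(n, k)%:R by rewrite ltr0n bin_gt0 ltnW.
rewrite /visit_prob -/P -/a in q0 *; set Q := p a in q0 *.
split; first by rewrite !mulr_gt0 ?exprn_gt0.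
rewrite lnM ?posrE ?mulr_gt0 ?exprn_gt0// lnM ?posrE ?exprn_gt0//.
rewrite !lnXn// ln_binomial// -/a.
clearbody a.
have -> : 1 + (P - a) / a = P / a by field; exact: lt0r_neq0.
have -> : 1 - (Q - a) / (1 - a) = (1 - Q) / (1 - a) by field; exact: lt0r_neq0.
rewrite !ln_div ?posrE// -[ln P *+ k]mulr_natr -[ln (1 - Q) *+ _]mulr_natr nkE aE.
move: (ln P) (ln (1 - Q)) (ln a) (ln (1 - a)) => A D F G; ring.
Qed.

End visit_probability.

(** * Local limit theorem *)

Section local_limit.
Context {R : realType}.
Variables (p : R -> R) (x alpha : R).
Hypotheses (x01 : 0 < x < 1) (px : p x = x) (dp : strictly_derivable p x alpha).

(** Only a lower bound is at stake, so the two logarithms of [ln_visit_prob]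
are replaced by their second order lower bounds. Along a sequence at distance
[O(sqrt n)] from [n x], every error term then tends to [0]. *)
Lemma visit_prob_along (M : R) (k : nat -> nat) :
  (forall n, `|(k n)%:R - n%:R * x| <= M * Num.sqrt n%:R) ->
  forall e : R, 0 < e -> \forall n \near \oo,
    gauss_visit x alpha e n (k n) <= visit_prob p n (k n).
Proof.
move=> kM e e0; have [x0 x1] := andP x01.
have y0 : 0 < 1 - x by lra.
pose r n : R := (Num.sqrt n%:R)^-1.
have r0 : r n @[n --> \oo] --> 0 by exact: cvg_inv_sqrt_nat.
have r2 n : r n ^+ 2 = n%:R^-1 by rewrite exprVn sqr_sqrtr.
(* the position in the window, on the scale [sqrt n] *)
pose b n := ((k n)%:R - n%:R * x) * r n.
have M0 : 0 <= M by have := kM 1%N; rewrite sqrtr1 mulr1; exact: le_trans.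
have bM n : `|b n| <= M.
  rewrite normrM [X in _ * X]ger0_norm ?invr_ge0 ?sqrtr_ge0//.
  have [->|n0] := posnP n; first by rewrite /r sqrtr0 invr0 mulr0.
  by rewrite ler_pdivrMr ?sqrtr_gt0 ?ltr0n.
pose a n := x + b n * r n.
have br0 : b n * r n @[n --> \oo] --> 0 by exact: (bounded_mul_cvg0 bM).
have ax : a n @[n --> \oo] --> x.
  by rewrite -[X in _ --> X]addr0; apply: cvgD => //; exact: cvg_cst.
have aE n : (0 < n)%N -> a n = (k n)%:R / n%:R.
  move=> n0; have n0' : (0 : R) < n%:R by rewrite ltr0n.
  rewrite /a /b -mulrA -expr2 r2; field; exact: lt0r_neq0.
(* [y n = (k n - 1) / n], since [r n ^+ 2 = 1 / n] *)
pose y n := a n - r n ^+ 2.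
have yx : y n @[n --> \oo] --> x.
  rewrite -[X in _ --> X]subr0 -[X in _ - X](mulr0 0).
  by apply: cvgB => //; under eq_fun do rewrite expr2; exact: cvgM.
have e1 : n%:R * (p (a n) - p (y n) - alpha * (a n - y n)) @[n --> \oo] --> 0.
  apply: (strictly_derivable_cvg (C := 1) dp yx ax) => n.
  rewrite /y opprB addrCA subrr addr0 r2.
  have [->|n0] := posnP n; first by rewrite mul0r normr0.
  by rewrite divff ?normr1// pnatr_eq0 -lt0n.
have e2 : Num.sqrt n%:R * (p (a n) - p x - alpha * (a n - x)) @[n --> \oo] --> 0.
  apply: (strictly_derivable_cvg (C := M) dp _ ax) => [|n]; first exact: cvg_cst.
  rewrite /a addrAC subrr add0r mulrCA /r.
  have [->|n0] := posnP n; first by rewrite sqrtr0 mul0r mulr0 normr0.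
  by rewrite divff ?mulr1// lt0r_neq0// sqrtr_gt0 ltr0n.
set eps1 := (fun n : nat => _ : R) in e1; set eps2 := (fun n : nat => _ : R) in e2.
pose B n := (alpha - 1) * b n.
have BC n : `|B n| <= `|alpha - 1| * M by rewrite normrM ler_wpM2l.
(* [(B n + E1 n) * r n = p (y n) - a n] and [(B n + eps2 n) * r n = p (a n) - a n] *)
pose E1 n := eps2 n - (alpha + eps1 n) * r n.
have E10 : E1 n @[n --> \oo] --> 0.
  rewrite -[X in _ --> X]subr0 -[X in _ - X](mulr0 (alpha + 0)).
  by apply: cvgB => //; apply: cvgM => //; apply: cvgD => //; exact: cvg_cst.
have ax' : 1 - a n @[n --> \oo] --> 1 - x by apply: cvgB => //; exact: cvg_cst.
pose u n := (B n + E1 n) * r n / a n.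
pose v n := (B n + eps2 n) * r n / (1 - a n).
have small (E : nat -> R) (c : nat -> R) (z : R) : E n @[n --> \oo] --> 0 ->
    c n @[n --> \oo] --> z -> z != 0 ->
    (B n + E n) * r n / c n @[n --> \oo] --> 0.
  move=> cE cc z0; rewrite -(mul0r z^-1); apply: cvgM; last exact: cvgV.
  have -> : (fun n => (B n + E n) * r n) = (fun n => B n * r n + E n * r n).
    by apply/funext => n; rewrite mulrDl.
  rewrite -(addr0 0); apply: cvgD; first exact: (bounded_mul_cvg0 BC).
  by rewrite -[X in _ --> X](mul0r 0); exact: cvgM.
have u0 : u n @[n --> \oo] --> 0 by exact: (small _ _ _ E10 ax (lt0r_neq0 x0)).
have v0 : v n @[n --> \oo] --> 0 by exact: (small _ _ _ e2 ax' (lt0r_neq0 y0)).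
have Q1 := perturbed_square_cvg0 BC E10 ax (lt0r_neq0 x0).
have Q2 := perturbed_square_cvg0 BC e2 ax' (lt0r_neq0 y0).
have S1 := small_mul_square_cvg0 BC E10 ax (lt0r_neq0 x0) u0.
have S2 := small_mul_square_cvg0 BC e2 ax' (lt0r_neq0 y0) v0.
pose lam := @log_stirling_const R.
have nfar (c : nat -> R) (z : R) : c n @[n --> \oo] --> z -> 0 < z ->
    forall A : nat, \forall n \near \oo, A%:R < n%:R * c n.
  move=> cz z0 A.
  have z2 : z / 2 < z by lra.
  have c2 : \forall n \near \oo, z / 2 < c n by apply: (cvgr_gt _ cz).
  have n2 : \forall n \near \oo, A%:R / (z / 2) < n%:R := nbhs_infty_gtr (A%:R / (z / 2)).
  near=> n.
  have cn : z / 2 < c n by near: n.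
  have An : A%:R / (z / 2) < n%:R by near: n.
  rewrite ltr_pdivrMr in An; last lra.
  by apply: (lt_le_trans An); rewrite ler_wpM2l// ltW.
have kfar := nfar _ _ ax x0; have nkfar := nfar _ _ ax' y0.
have ncE n : (0 < n)%N -> n%:R * a n = (k n)%:R.
  by move=> n0; rewrite aE// mulrC divfK// pnatr_eq0 -lt0n.
have kn : \forall n \near \oo, (0 < k n < n)%N.
  have k1 := kfar 0%N; have k2 := nkfar 0%N.
  near=> n.
  have n0 : (0 < n)%N by near: n; exists 1%N.
  have h1 : 0%:R < n%:R * a n by near: n.
  have h2 : 0%:R < n%:R * (1 - a n) by near: n.
  move: h1 h2; rewrite mulrBr mulr1 ncE// subr_gt0 ltr0n ltr_nat => -> ->.
  by [].
have cvg_nat (c : nat -> R) (h : nat -> nat) :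
    (forall A : nat, \forall n \near \oo, A%:R < n%:R * c n) ->
    (\forall n \near \oo, n%:R * c n = (h n)%:R) -> log_stirling (h n) @[n --> \oo] --> lam.
  move=> cfar hE; have ho : h n @[n --> \oo] --> \oo.
    apply/cvgnyPge => A; have cA := cfar A; near=> n.
    have h1 : A%:R < n%:R * c n by near: n.
    have h2 : n%:R * c n = (h n)%:R by near: n.
    by rewrite h2 ltr_nat in h1; exact: ltnW.
  exact: (cvg_comp _ _ ho cvg_log_stirling).
have lk : log_stirling (k n) @[n --> \oo] --> lam.
  by apply: (cvg_nat a k kfar); exists 1%N => // n; exact: ncE.
have lnk : log_stirling (n - k n)%N @[n --> \oo] --> lam.
  apply: (cvg_nat _ (fun n => n - k n)%N nkfar).
  have n1 : \forall n \near \oo, (0 < n)%N by exists 1%N.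
  apply: filterS2 kn n1 => n /andP[_ /ltnW knn] n0.
  by rewrite mulrBr mulr1 ncE// natrB.
(* the lower bound for the logarithm of [visit_prob], up to the Gaussian exponent
   and [ln n / 2] *)
pose LB n := log_stirling n - log_stirling (k n) - log_stirling (n - k n)
   - ln (a n) / 2 - ln (1 - a n) / 2 - (alpha + eps1 n)
   - ((B n + E1 n) ^+ 2 / a n - B n ^+ 2 / x) / 2
   - ((B n + eps2 n) ^+ 2 / (1 - a n) - B n ^+ 2 / (1 - x)) / 2
   - `|u n| * ((B n + E1 n) ^+ 2 / a n)
   - `|v n| * ((B n + eps2 n) ^+ 2 / (1 - a n)).
have cln (c : nat -> R) (z : R) : c n @[n --> \oo] --> z -> 0 < z ->
    ln (c n) / 2 @[n --> \oo] --> ln z / 2.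
  move=> cz z0; apply: cvgM; last exact: cvg_cst.
  by apply: continuous_cvg => //; exact: continuous_ln.
have half (c : nat -> R) (z : R) : c n @[n --> \oo] --> z -> c n / 2 @[n --> \oo] --> z / 2.
  by move=> cz; apply: cvgM => //; exact: cvg_cst.
have LBlim : LB n @[n --> \oo] --> lam - lam - lam - ln x / 2 - ln (1 - x) / 2
    - (alpha + 0) - 0 / 2 - 0 / 2 - 0 - 0.
  apply: cvgB S2; apply: cvgB S1.
  apply: cvgB (half _ _ Q2); apply: cvgB (half _ _ Q1).
  have a1 : alpha + eps1 n @[n --> \oo] --> alpha + 0 by apply: cvgD => //; exact: cvg_cst.
  apply: cvgB a1; apply: cvgB (cln _ _ ax' y0); apply: cvgB (cln _ _ ax x0).
  by apply: cvgB lnk; apply: cvgB lk; exact: cvg_log_stirling.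
have LBge : \forall n \near \oo,
    - ln (Num.sqrt (2 * pi)) - ln x / 2 - ln (1 - x) / 2 - alpha - e <= LB n.
  apply: (cvgr_ge _ LBlim).
  have := @log_stirling_const_le_gauss R; rewrite -/lam; lra.
have h0 : 0 < 2^-1 :> R by [].
have us : \forall n \near \oo, `|u n| <= 2^-1 by move/cvgr0Pnorm_le : u0 => /(_ _ h0).
have vs : \forall n \near \oo, `|v n| <= 2^-1 by move/cvgr0Pnorm_le : v0 => /(_ _ h0).
near=> n.
have n0 : (0 < n)%N by near: n; exists 1%N.
have knn : (0 < k n < n)%N by near: n.
have un : `|u n| <= 2^-1 by near: n.
have vn : `|v n| <= 2^-1 by near: n.
have LBn : - ln (Num.sqrt (2 * pi)) - ln x / 2 - ln (1 - x) / 2 - alpha - e <= LB n by near: n.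
have n0' : (0 : R) < n%:R by rewrite ltr0n.
have sn0 : 0 < Num.sqrt (n%:R : R) by rewrite sqrtr_gt0.
have a0 : 0 < a n by rewrite aE// divr_gt0// ltr0n; case/andP: knn.
have a1 : 0 < 1 - a n.
  by rewrite subr_gt0 aE// ltr_pdivrMr// mul1r ltr_nat; case/andP: knn.
have yE : ((k n)%:R - 1) / n%:R = y n by rewrite /y aE// r2 mulrBl mul1r.
have rn : r n * Num.sqrt n%:R = 1 by rewrite /r mulVf// lt0r_neq0.
have nr : n%:R * r n ^+ 2 = 1 by rewrite r2 divff// lt0r_neq0.
have paE : p (a n) - a n = (B n + eps2 n) * r n.
  transitivity ((alpha - 1) * (b n * r n)
      + (r n * Num.sqrt n%:R) * (p (a n) - x - alpha * (a n - x))).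
    rewrite rn; have : a n = x + b n * r n by [].
    by move: (p (a n)) (a n) (b n * r n) => t1 t2 t3 ->; ring.
  by rewrite /B /eps2 px; ring.
have pyE : p (y n) - a n = (B n + E1 n) * r n.
  transitivity ((p (a n) - a n) - (alpha * r n ^+ 2
     + (n%:R * r n ^+ 2) * (p (a n) - p (y n) - alpha * r n ^+ 2))).
    by rewrite nr; ring.
  rewrite paE /E1 /eps1.
  have -> : a n - y n = r n ^+ 2 by rewrite /y; ring.
  ring.
have uE : (p (y n) - a n) / a n = u n by rewrite pyE.
have vE : (p (a n) - a n) / (1 - a n) = v n by rewrite paE.
have py0 : 0 < p (y n).
  have -> : p (y n) = a n * (1 + u n) by rewrite -uE; field; exact: lt0r_neq0.
  by rewrite mulr_gt0//; move: un; rewrite ler_norml; lra.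
have pa0 : 0 < 1 - p (a n).
  have -> : 1 - p (a n) = (1 - a n) * (1 - v n) by rewrite -vE; field; exact: lt0r_neq0.
  by rewrite mulr_gt0//; move: vn; rewrite ler_norml; lra.
have := @ln_visit_prob R p n (k n) knn; rewrite yE -aE// => /(_ py0 pa0)[m0 lnm].
have lu := ln1D_ge_quad un.
have lv : - v n - v n ^+ 2 / 2 - `|v n| ^+ 3 <= ln (1 - v n).
  by have := @ln1D_ge_quad R (- v n); rewrite normrN sqrrN; exact.
have lower : LB n - ln n%:R / 2 - B n ^+ 2 / (2 * (x * (1 - x))) <= ln (visit_prob p n (k n)).
  have bound (c w l W : R) : 0 < c -> w - w ^+ 2 / 2 - `|w| ^+ 3 <= l ->
      n%:R * (c * w ^+ 2) = W ->
      n%:R * (c * w) - W / 2 - `|w| * W <= n%:R * (c * l).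
    move=> c0 wl <-.
    have -> : n%:R * (c * w) - n%:R * (c * w ^+ 2) / 2 - `|w| * (n%:R * (c * w ^+ 2))
        = n%:R * (c * (w - w ^+ 2 / 2 - `|w| ^+ 3)).
      have -> : `|w| ^+ 3 = `|w| * w ^+ 2 by rewrite exprS real_normK ?num_real.
      by ring.
    by rewrite ler_pM2l// ler_pM2l.
  have W1 : n%:R * (a n * u n ^+ 2) = (B n + E1 n) ^+ 2 / a n.
    transitivity ((n%:R * r n ^+ 2) * ((B n + E1 n) ^+ 2 / a n)); last by rewrite nr mul1r.
    by rewrite /u; field; exact: lt0r_neq0.
  have W2 : n%:R * ((1 - a n) * (- v n) ^+ 2) = (B n + eps2 n) ^+ 2 / (1 - a n).
    transitivity ((n%:R * r n ^+ 2) * ((B n + eps2 n) ^+ 2 / (1 - a n))).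
      by rewrite /v; field; exact: lt0r_neq0.
    by rewrite nr mul1r.
  have b1 := bound _ _ _ _ a0 lu W1.
  have b2 : n%:R * ((1 - a n) * - v n) - (B n + eps2 n) ^+ 2 / (1 - a n) / 2
      - `|v n| * ((B n + eps2 n) ^+ 2 / (1 - a n)) <= n%:R * ((1 - a n) * ln (1 - v n)).
    by rewrite -(normrN (v n)); apply: bound => //; rewrite normrN sqrrN.
  (* the linear terms of the two logarithms leave [- alpha] *)
  have lin : n%:R * (a n * u n) + n%:R * ((1 - a n) * - v n) = - (alpha + eps1 n).
    have -> : a n * u n = p (y n) - a n by rewrite -uE; field; exact: lt0r_neq0.
    have -> : (1 - a n) * - v n = - (p (a n) - a n) by rewrite -vE; field; exact: lt0r_neq0.
    rewrite pyE paE /E1.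
    transitivity (- ((n%:R * r n ^+ 2) * (alpha + eps1 n))); first by ring.
    by rewrite nr mul1r.
  have BE : B n ^+ 2 / (2 * (x * (1 - x))) = (B n ^+ 2 / x + B n ^+ 2 / (1 - x)) / 2.
    by field; rewrite !lt0r_neq0.
  rewrite lnm uE vE /LB BE.
  move: b1 b2 lin.
  move: ((B n + E1 n) ^+ 2 / _) ((B n + eps2 n) ^+ 2 / _) => U3 U4.
  move: (`|u n| * U3) (`|v n| * U4) => U1 U2.
  move: (n%:R * (a n * u n)) (n%:R * ((1 - a n) * - v n)) => t1 t2.
  move: (n%:R * (a n * ln _)) (n%:R * ((1 - a n) * ln _)) => N1 N2.
  move: (B n ^+ 2 / x) (B n ^+ 2 / (1 - x)) => B1 B2.
  move: (ln (a n)) (ln (1 - a n)) (ln n%:R) (log_stirling n) (log_stirling (k n)).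
  move: (log_stirling (n - k n)) (eps1 n) => L1 ep L2 L3 L4 L5 L6.
  lra.
rewrite -[leRHS]lnK ?posrE// /gauss_visit.
have c0 : 0 < x * (1 - x) by rewrite mulr_gt0.
have p0 := @pi_gt0 R.
have s0 : 0 < Num.sqrt (2 * pi * (x * (1 - x)) * n%:R) by rewrite sqrtr_gt0 !mulr_gt0.
rewrite -[X in _ / X]lnK ?posrE// -expRN -expRD ler_expR; apply: le_trans lower.
have -> : (alpha - 1) * ((k n)%:R - n%:R * x) / Num.sqrt n%:R = B n.
  by rewrite /B /b mulrA.
rewrite ln_sqrt ?mulr_gt0// !lnM ?posrE ?mulr_gt0//.
move: LBn; rewrite ln_sqrt ?mulr_gt0// lnM ?posrE//.
move: (LB n) (B n ^+ 2 / _) (ln pi) (ln 2) (ln x) (ln (1 - x)) (ln n%:R).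
by move=> A1 A2 A3 A4 A5 A6 A7; lra.
Unshelve. all: by end_near. Qed.

End local_limit.

(** * The expected number of equilibria near the fixed point *)

Section expected_visits.
Context {R : realType}.
Variables (p : R -> R) (x alpha : R).
Hypotheses (x01 : 0 < x < 1) (px : p x = x) (dp : strictly_derivable p x alpha).

(** The bound along sequences is uniform over the window: apply it to a
sequence that picks an index violating the bound whenever there is one. *)
Lemma visit_prob_window (M : R) : 1 <= M -> forall e : R, 0 < e ->
  \forall n \near \oo, forall k : nat,
    `|k%:R - n%:R * x| <= M * Num.sqrt n%:R ->
    gauss_visit x alpha e n k <= visit_prob p n k.
Proof.
move=> M1 e e0; have [x0 x1] := andP x01.
pose bound n k := gauss_visit x alpha e n k <= visit_prob p n k.
pose win n k := `|k%:R - n%:R * x| <= M * Num.sqrt n%:R.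
pose bad n k := win n k /\ ~ bound n k.
pose k0 n := Num.truncn (n%:R * x).
have k0w n : win n (k0 n).
  have nx : 0 <= n%:R * x by rewrite mulr_ge0// ltW.
  have /andP[l u] := truncn_itv nx.
  have [->|n0] := posnP n; last first.
    apply: (@le_trans _ _ 1).
      by rewrite ler_norml; move: u; rewrite -natr1 /k0; lra.
    by rewrite -[leLHS]mulr1 ler_pM// -[leLHS]sqrtr1 ler_sqrt ?ler1n.
  rewrite /win /k0 !mul0r truncn0 subrr normr0 mulr_ge0 ?sqrtr_ge0//; lra.
pose k n := if pselect (exists k, bad n k) is left h then sval (cid h) else k0 n.
have kw n : win n (k n).
  by rewrite /k; case: pselect => [h|_]; [case: (svalP (cid h))|exact: k0w].
have kb n : bound n (k n) -> forall j, win n j -> bound n j.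
  rewrite /k; case: pselect => [h|h _ j wj].
    by case: (svalP (cid h)) => _ nb /nb.
  by apply: contrapT => nb; apply: h; exists j.
have := visit_prob_along x01 px dp kw e0.
by apply: filterS => n /kb.
Qed.


(** The slope [alpha - 1] of [p a - a] contracts the Gaussian of variance [x (1
- x)], hence the factor [1 / (alpha - 1)] once a density is factored out. *)
Lemma gauss_visitE (e : R) n k : 1 < alpha -> (0 < n)%N ->
  let s := Num.sqrt (x * (1 - x)) / (alpha - 1) in
  let r := (Num.sqrt n%:R)^-1 in
  gauss_visit x alpha e n k =
  expR (- alpha - e) / (alpha - 1) * (normal_pdf 0 s ((k%:R - n%:R * x) * r) * r).
Proof.
move=> al1 n0 s r; have [x0 x1] := andP x01.
have al0 : 0 < alpha - 1 by lra.
have c0 : 0 < x * (1 - x) by rewrite mulr_gt0// subr_gt0.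
have s0 : 0 < s by rewrite divr_gt0 ?sqrtr_gt0.
have s2 : s ^+ 2 = x * (1 - x) / (alpha - 1) ^+ 2.
  by rewrite /s exprMn exprVn sqr_sqrtr// ltW.
have p0 := @pi_gt0 R.
have n0' : (0 : R) < n%:R by rewrite ltr0n.
have sn0 : 0 < Num.sqrt (n%:R : R) by rewrite sqrtr_gt0.
have sp0 : 0 < Num.sqrt (2 * pi * (x * (1 - x))).
  by rewrite sqrtr_gt0 mulr_gt0// mulr_gt0.
have peakE : normal_peak s = (alpha - 1) / Num.sqrt (2 * pi * (x * (1 - x))).
  rewrite /normal_peak.
  have <- : Num.sqrt (s ^+ 2 * pi *+ 2) * (alpha - 1) = Num.sqrt (2 * pi * (x * (1 - x))).
    have aE : alpha - 1 = Num.sqrt ((alpha - 1) ^+ 2) by rewrite sqrtr_sqr gtr0_norm.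
    rewrite {1}aE -sqrtrM; last by rewrite mulrn_wge0// mulr_ge0 ?sqr_ge0// ltW.
    congr Num.sqrt; rewrite s2 -mulr_natl; field; exact: lt0r_neq0.
  have z0 : 0 < Num.sqrt (s ^+ 2 * pi *+ 2).
    by rewrite sqrtr_gt0 mulrn_wgt0// mulr_gt0// exprn_gt0.
  by field; rewrite !lt0r_neq0.
rewrite normal_pdfE ?lt0r_neq0// peakE /normal_fun subr0 s2 /gauss_visit expRD.
rewrite (sqrtrM n%:R); last by apply: mulr_ge0; [rewrite mulr_ge0// ltW | exact: ltW].
have -> : - ((k%:R - n%:R * x) * r) ^+ 2 / (x * (1 - x) / (alpha - 1) ^+ 2 *+ 2) =
  - (((alpha - 1) * (k%:R - n%:R * x) / Num.sqrt n%:R) ^+ 2 / (2 * (x * (1 - x)))).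
  by rewrite /r; field; rewrite !lt0r_neq0//; lra.
by rewrite /r; field; rewrite !lt0r_neq0.
Qed.

(** Over a cell of length [h] the logarithm of the density varies by at most
[(M + 1) h / s ^ 2]. *)
Lemma normal_cell_le (s M h u v : R) : 0 < s -> 0 <= h <= 1 -> `|u| <= M ->
  v = u + h ->
  normal_cdf s v - normal_cdf s u <=
  expR ((M + 1) / s ^+ 2 * h) * (normal_pdf 0 s u * h).
Proof.
move=> s0 /andP[h0 h1] uM ->.
have uuh : u <= u + h by rewrite lerDl.
apply: (le_trans (normal_cdf_le (b := expR ((M + 1) / s ^+ 2 * h) * normal_pdf 0 s u) uuh _)).
  move=> z /andP[uz zh].
  rewrite normal_pdfE ?lt0r_neq0// mulrCA ler_pM2l ?normal_peak_gt0 ?lt0r_neq0//.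
  rewrite /normal_fun -expRD ler_expR !subr0 !mulNr.
  have s2 : 0 < s ^+ 2 by rewrite exprn_gt0.
  have -> : (M + 1) / s ^+ 2 * h - u ^+ 2 / (s ^+ 2 *+ 2) =
     (2 * (M + 1) * h - u ^+ 2) / (s ^+ 2 *+ 2) by field; exact: lt0r_neq0.
  rewrite -mulNr ler_pM2r ?invr_gt0 ?pmulrn_lgt0//.
  move: uM; rewrite ler_norml => /andP[Mu uM].
  have : (z - u) * (z + u) >= - (h * (2 * (M + 1))).
    have [uz0|uz0] := leP 0 (z + u).
      by apply: (@le_trans _ _ 0); [rewrite oppr_le0 !mulr_ge0//; lra|rewrite mulr_ge0//; lra].
    rewrite -lerN2 opprK -mulrN ler_pM//; lra.
  by rewrite -subr_sqr; lra.
by rewrite addrAC subrr add0r mulrA.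
Qed.

Lemma visit_prob_ge0 n k : (forall a, 0 <= p a <= 1) -> 0 <= visit_prob p n k.
Proof.
move=> p01; have P a : 0 <= p a by case/andP: (p01 a).
have Q a : 0 <= 1 - p a by rewrite subr_ge0; case/andP: (p01 a).
by rewrite /visit_prob !mulr_ge0 ?exprn_ge0.
Qed.

(** The indices at distance at most [M sqrt n] from [n x] give a Riemann sum,
of mesh [1 / sqrt n], of a normal density over a window of mass almost [1]. The
loss [kap] is shared between the mass, the factor [exp (- e)] and the variation
of the density over a cell. *)
Lemma expected_visits_ge (kap eta : R) : 1 < alpha -> (forall a, 0 <= p a <= 1) ->
  0 < kap -> kap < 1 -> 0 < eta ->
  \forall n \near \oo, (1 - kap) * (expR (- alpha) / (alpha - 1)) <=
    \sum_(0 <= k < n.+1 | `|x - k%:R / n%:R| < eta) visit_prob p n k.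
Proof.
move=> al1 p01 kap0 kap1 eta0; have [x0 x1] := andP x01.
have al0 : 0 < alpha - 1 by lra.
have c0 : 0 < x * (1 - x) by rewrite mulr_gt0// subr_gt0.
set s := Num.sqrt (x * (1 - x)) / (alpha - 1).
have s0 : 0 < s by rewrite divr_gt0 ?sqrtr_gt0.
have [M M0 NM] := @normal_cdf_window R s (kap / 3) ltac:(lra).
have M1 : 1 <= M + 1 by lra.
pose e := kap / 6; have e0 : 0 < e by rewrite /e; lra.
have win := visit_prob_window M1 e0.
pose C := (M + 1 + 1) / s ^+ 2.
have C0 : 0 < C by rewrite divr_gt0 ?exprn_gt0//; lra.
have small (z : R) : 0 < z -> \forall n \near \oo, (M + 1) * (Num.sqrt n%:R)^-1 < z.
  move=> z0.
  have M10 : 0 < M + 1 by lra.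
  move/cvgr0Pnorm_lt : (@cvg_inv_sqrt_nat R) => /(_ (z / (M + 1)) (divr_gt0 z0 M10)).
  apply: filterS => n; rewrite ger0_norm ?invr_ge0 ?sqrtr_ge0//.
  by rewrite ltr_pdivlMr// mulrC.
have smalleta := small eta eta0.
have smallx := small x x0.
have small1x : \forall n \near \oo, (M + 1) * (Num.sqrt n%:R)^-1 < 1 - x.
  by apply: small; lra.
have small1 := small 1 ltr01.
have smalle : \forall n \near \oo, (M + 1) * (Num.sqrt n%:R)^-1 < e / C * (M + 1).
  by apply: small; apply: mulr_gt0; [exact: divr_gt0 | lra].
near=> n.
have n0 : (0 < n)%N by near: n; exists 1%N.
have n0' : (0 : R) < n%:R by rewrite ltr0n.
have sn0 : 0 < Num.sqrt (n%:R : R) by rewrite sqrtr_gt0.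
have heta : (M + 1) * (Num.sqrt n%:R)^-1 < eta by near: n.
have hx : (M + 1) * (Num.sqrt n%:R)^-1 < x by near: n.
have h1x : (M + 1) * (Num.sqrt n%:R)^-1 < 1 - x by near: n.
have h1 : (M + 1) * (Num.sqrt n%:R)^-1 < 1 by near: n.
have he : (M + 1) * (Num.sqrt n%:R)^-1 < e / C * (M + 1) by near: n.
have wn : forall k : nat, `|k%:R - n%:R * x| <= (M + 1) * Num.sqrt n%:R ->
    gauss_visit x alpha e n k <= visit_prob p n k by near: n.
set sq := Num.sqrt (n%:R : R) in sn0 heta hx h1x h1 he wn *.
set r := sq^-1 in heta hx h1x h1 he *.
have rsq : r * sq = 1 by rewrite mulVf// lt0r_neq0.
have r0 : 0 < r by rewrite invr_gt0.
have sqn : sq * sq = n%:R by rewrite -expr2 sqr_sqrtr.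
have sq1 : 1 <= sq by rewrite -[leLHS]sqrtr1 ler_sqrt// ler1n.
have rn z : z * r * n%:R = z * sq by rewrite -sqn -mulrA [r * _]mulrA rsq mul1r.
have Msqx : (M + 1) * sq < n%:R * x.
  by rewrite -rn mulrC ltr_pM2l.
have Msq1x : n%:R * x + (M + 1) * sq < n%:R.
  by have := h1x; rewrite -(ltr_pM2r n0') rn mulrBl mul1r; lra.
have lo0 : 0 <= n%:R * x - M * sq by move: Msqx sq1; rewrite mulrDl; lra.
have hi0 : 0 <= n%:R * x + M * sq.
  by rewrite addr_ge0 ?mulr_ge0 ?ltW.
have /andP[K1l K1u] := truncn_itv lo0; have /andP[K2l K2u] := truncn_itv hi0.
set K1 := Num.truncn _ in K1l K1u; set K2' := Num.truncn _ in K2l K2u.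
pose K2 := K2'.+1.
rewrite -natr1 in K1u.
have K12 : (K1 <= K2)%N.
  rewrite -(ler_nat R) /K2 (le_trans K1l)// ltW// (le_lt_trans _ K2u)//.
  have : 0 <= M * sq by rewrite mulr_ge0 ?ltW.
  by lra.
have K2n : (K2 <= n.+1)%N.
  rewrite ltnW// ltnS -(ler_nat R) /K2 -natr1; move: Msq1x; rewrite mulrDl; lra.
pose u k : R := (k%:R - n%:R * x) * r.
have kin k : (K1 <= k < K2)%N -> `|k%:R - n%:R * x| <= (M + 1) * sq.
  move=> /andP[Kk kK]; rewrite ler_norml mulrDl mul1r.
  have : K1%:R <= k%:R :> R by rewrite ler_nat.
  have : k%:R <= K2'%:R :> R by rewrite ler_nat.
  by move: K1u K2l sq1; lra.
have kcond k : (K1 <= k < K2)%N -> `|x - k%:R / n%:R| < eta.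
  move=> /kin kk; apply: le_lt_trans heta.
  rewrite -(ler_pM2r n0') rn; apply: le_trans kk.
  rewrite -[X in _ * X](gtr0_norm n0') -normrM mulrBl divfK ?lt0r_neq0//.
  by rewrite distrC mulrC.
have vge k : (K1 <= k < K2)%N ->
    expR (- alpha - e) / (alpha - 1) * expR (- (C * r)) *
     (normal_cdf s (u k.+1) - normal_cdf s (u k)) <= visit_prob p n k.
  move=> /kin kk; apply: le_trans (wn _ kk).
  rewrite gauss_visitE// -/s -/r -mulrA ler_pM2l; last by rewrite divr_gt0// expR_gt0.
  rewrite expRN mulrC ler_pdivrMr ?expR_gt0// [leRHS]mulrC.
  apply: (normal_cell_le s0).
  - by rewrite (ltW r0)/= (le_trans _ (ltW h1))// ler_peMl// ltW.
  - by rewrite normrM (gtr0_norm r0) ler_pdivrMr.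
  - by rewrite /u -natr1; ring.
have v0 k := @visit_prob_ge0 n k p01.
apply: (@le_trans _ _ (\sum_(K1 <= k < K2) visit_prob p n k)); last first.
  rewrite [leRHS](@big_cat_nat _ _ _ K2)//= [X in _ <= X + _](@big_cat_nat _ _ _ K1)//=.
  rewrite -addrA ler_wpDl ?sumr_ge0// ler_wpDr ?sumr_ge0//.
  rewrite big_nat_cond [leRHS]big_nat_cond.
  rewrite le_eqVlt; apply/orP; left; apply/eqP; apply: eq_bigl => k.
  by rewrite andbT; apply/idP/andP => [kk|[]//]; rewrite kk kcond.
apply: (@le_trans _ _ (\sum_(K1 <= k < K2)
    expR (- alpha - e) / (alpha - 1) * expR (- (C * r)) *
     (normal_cdf s (u k.+1) - normal_cdf s (u k)))); last first.
  by rewrite big_nat_cond [leRHS]big_nat_cond; apply: ler_sum => k; rewrite andbT; exact: vge.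
rewrite -mulr_sumr telescope_sumr//.
have uK2 : M <= u K2.
  by rewrite /u ler_pdivlMr//; move: K2u; rewrite -/K2; lra.
have uK1 : u K1 <= - M.
  by rewrite /u ler_pdivrMr//; move: K1l; lra.
have NN : 1 - kap / 3 <= normal_cdf s (u K2) - normal_cdf s (u K1).
  by apply: le_trans NM _; apply: lerB; exact: normal_cdf_nd.
have Ere : 1 - kap / 3 <= expR (- e) * expR (- (C * r)).
  rewrite -expRD; apply: le_trans (expR_ge1Dx _).
  have : C * r < e.
    by rewrite mulrC -ltr_pdivlMr//; rewrite [ltRHS]mulrC ltr_pM2l in he => //; lra.
  by rewrite /e; lra.
rewrite expRD.
have k30 : 0 <= 1 - kap / 3 by lra.
have := ler_pM k30 k30 Ere NN.
have A0 : 0 < expR (- alpha) / (alpha - 1) by rewrite divr_gt0// expR_gt0.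
rewrite -(ler_pM2l A0) => H.
apply: (@le_trans _ _ (expR (- alpha) / (alpha - 1) * ((1 - kap / 3) * (1 - kap / 3)))).
  rewrite mulrC ler_pM2l//.
  have := sqr_ge0 kap; nra.
apply: le_trans H _.
by rewrite le_eqVlt; apply/orP; left; apply/eqP; ring.
Unshelve. all: by end_near. Qed.

End expected_visits.

(** * Two equilibria near the fixed point *)

Section revisits.
Context {R : realType}.

Lemma fact_ge_stirling j : (0 < j)%N ->
  expR (3 / 4) * j%:R ^+ j * Num.sqrt j%:R <= j`!%:R * expR j%:R :> R.
Proof.
move=> j0; have j0' : (0 : R) < j%:R by rewrite ltr0n.
have s0 : 0 < Num.sqrt (j%:R : R) by rewrite sqrtr_gt0.
have f0 : (0 : R) < j`!%:R by rewrite ltr0n fact_gt0.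
rewrite -ler_ln ?posrE ?mulr_gt0 ?expR_gt0 ?exprn_gt0//.
rewrite lnM ?posrE ?mulr_gt0 ?expR_gt0 ?exprn_gt0//.
rewrite lnM ?posrE ?expR_gt0 ?exprn_gt0// lnM ?posrE ?expR_gt0//.
rewrite !expRK ln_sqrt// lnXn// -[ln _ *+ j]mulr_natr.
by have := @log_stirling_ge R j j0; rewrite /log_stirling; lra.
Qed.

Lemma a0_lt0 (alpha : R) : 1 < alpha -> a0 alpha < 0.
Proof.
move=> al1; rewrite /a0 -ltr_expR expRD lnK ?posrE; last lra.
have := @expR_gt1Dx R (alpha - 1); rewrite subr_eq0 gt_eqF// => /(_ isT).
rewrite addrCA subrr addr0 expR0 => H.
by rewrite -[1 - alpha]opprB expRN mulrC ltr_pdivrMr ?expR_gt0// mul1r.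
Qed.

(** Given that [k] is an equilibrium, [k + j] is one with probability close to
the Poisson value [exp (- alpha j) (alpha (j - 1)) ^ j / j!]. By Stirling's
formula this is below [exp (- 1) exp (- a j) / sqrt (2 pi j)] with [a = - a0
alpha]; the factor [exp (- 1)] gives room to lower the rate to [7 a / 8]. *)
Definition revisit_weight (a : R) j : R :=
  expR (- (7 / 4)) * (expR (- (7 / 8 * a * j%:R)) / Num.sqrt j%:R).

(** The slope of [p] is known up to [tau] only, which costs at most [2 tau <= a
/ 8] in the rate [a = - a0 alpha]. *)
Lemma poisson_term_le (alpha tau : R) j : 1 < alpha -> (0 < j)%N -> 0 < tau ->
  tau <= - a0 alpha / 16 ->
  ((alpha + tau) * (j%:R - 1)) ^+ j / j`!%:R * expR (- ((alpha - tau) * j%:R)) <=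
  revisit_weight (- a0 alpha) j.
Proof.
move=> al1 j0 t0 t1; have j0' : (0 : R) < j%:R by rewrite ltr0n.
have s0 : 0 < Num.sqrt (j%:R : R) by rewrite sqrtr_gt0.
have f0 : (0 : R) < j`!%:R by rewrite ltr0n fact_gt0.
have at0 : 0 < alpha + tau by lra.
have j1 : 0 <= j%:R - 1 :> R by rewrite subr_ge0 ler1n.
have pj : (j%:R - 1) ^+ j <= j%:R ^+ j * expR (- 1) :> R.
  have -> : expR (- 1) = expR (- j%:R^-1) ^+ j :> R.
    by rewrite -expRM_natl mulrN divff// lt0r_neq0.
  rewrite -exprMn; apply: lerXn2r; rewrite ?nnegrE ?mulr_ge0 ?expR_ge0 ?(ltW j0')//.
  have -> : j%:R - 1 = j%:R * (1 - j%:R^-1) :> R by field; exact: lt0r_neq0.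
  by rewrite ler_pM2l// expR_ge1Dx.
have lnat : ln (alpha + tau) <= ln alpha + tau.
  have -> : alpha + tau = alpha * (1 + tau / alpha) by field; apply: lt0r_neq0; lra.
  have ta0 : 0 < tau / alpha by rewrite divr_gt0//; lra.
  rewrite lnM ?posrE; [|lra|lra].
  rewrite lerD2l; apply: (@le_trans _ _ (tau / alpha)); first by apply: le_ln1Dx; lra.
  by rewrite ler_pdivrMr; [rewrite ler_peMr//; lra|lra].
have atj : (alpha + tau) ^+ j = expR (ln (alpha + tau) * j%:R).
  by rewrite expRM_natr lnK.
have F := fact_ge_stirling j0.
rewrite mulrAC ler_pdivrMr//.
apply: (@le_trans _ _ ((alpha + tau) ^+ j * (j%:R ^+ j * expR (- 1)) *
    expR (- ((alpha - tau) * j%:R)))).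
  by rewrite exprMn ler_wpM2r ?expR_ge0// ler_wpM2l// exprn_ge0// ltW.
apply: (@le_trans _ _ (revisit_weight (- a0 alpha) j *
    (expR (3 / 4) * j%:R ^+ j * Num.sqrt j%:R * expR (- j%:R)))); last first.
  rewrite ler_wpM2l//; first by rewrite mulr_ge0 ?divr_ge0 ?expR_ge0// ltW.
  by rewrite expRN ler_pdivrMr ?expR_gt0.
rewrite /revisit_weight.
have -> : expR (- (7 / 4)) * (expR (- (7 / 8 * - a0 alpha * j%:R)) / Num.sqrt j%:R) *
    (expR (3 / 4) * j%:R ^+ j * Num.sqrt j%:R * expR (- j%:R)) =
    j%:R ^+ j * (expR (- (7 / 4)) * expR (- (7 / 8 * - a0 alpha * j%:R)) *
    expR (3 / 4) * expR (- j%:R)).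
  by field; exact: lt0r_neq0.
rewrite atj [X in X * _]mulrCA -[leLHS]mulrA ler_pM2l ?exprn_gt0//.
rewrite -!expRD ler_expR.
have : j%:R * (ln (alpha + tau) + tau - alpha) <= j%:R * (7 / 8 * a0 alpha - 1) :> R.
  by rewrite ler_pM2l//; rewrite /a0 in t1 *; lra.
lra.
Qed.


(** [k] players stop at the level [(k - 1) / n], [l - k] more between the
levels [k / n] and [(l - 1) / n], and the others not even at the level [l / n].
*)
Definition pair_prob (p : R -> R) n k l : R :=
  'C(n, k)%:R * 'C(n - k, l - k)%:R * p ((k%:R - 1) / n%:R) ^+ k *
  (p ((l%:R - 1) / n%:R) - p (k%:R / n%:R)) ^+ (l - k) *
  (1 - p (l%:R / n%:R)) ^+ (n - l).

Lemma bin_le_pow m j : 'C(m, j)%:R <= m%:R ^+ j / j`!%:R :> R.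
Proof.
rewrite ler_pdivlMr ?ltr0n ?fact_gt0// -natrM bin_ffact -natrX ler_nat.
elim: j m => [|j ih] m; first by rewrite ffactn0 expn0.
case: m => [|m]; first by rewrite ffact0n.
rewrite ffactnS expnS leq_mul//= (leq_trans (ih m))//.
by have [->|j0] := posnP j; rewrite ?expn0// leq_exp2r.
Qed.

(** The comparison of the binomial law of the [m] players that do not stop at
[k] with a Poisson law, where [s] is the probability of not stopping. *)
Lemma thinned_binomial_le (m j : nat) (s D D' A B : R) :
  (j <= m)%N -> 0 < s -> 0 <= D' -> 0 <= s - D ->
  m%:R * D' <= A * s -> B * s <= (m - j)%:R * D ->
  'C(m, j)%:R * D' ^+ j * (s - D) ^+ (m - j) <=
  s ^+ m * (A ^+ j / j`!%:R * expR (- B)).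
Proof.
move=> jm s0 D0 sD hA hB.
have f0 : (0 : R) < j`!%:R by rewrite ltr0n fact_gt0.
have h1 : 'C(m, j)%:R * D' ^+ j <= s ^+ j * (A ^+ j / j`!%:R).
  apply: (le_trans (ler_wpM2r (exprn_ge0 _ D0) (bin_le_pow m j))).
  rewrite mulrAC -exprMn mulrA -exprMn ler_pM2r ?invr_gt0// [s * A]mulrC.
  have mD0 : 0 <= m%:R * D' by rewrite mulr_ge0.
  by apply: lerXn2r => //; rewrite nnegrE// (le_trans mD0).
have h2 : (s - D) ^+ (m - j) <= s ^+ (m - j) * expR (- B).
  apply: (@le_trans _ _ (s ^+ (m - j) * expR (- ((m - j)%:R * D / s)))).
    rewrite -mulrA -mulrN expRM_natl -exprMn; apply: lerXn2r;
      rewrite ?nnegrE ?mulr_ge0 ?expR_ge0 ?(ltW s0)//.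
    have -> : s - D = s * (1 + - (D / s)) by field; exact: lt0r_neq0.
    by rewrite ler_pM2l// expR_ge1Dx.
  by rewrite ler_pM2l ?exprn_gt0// ler_expR lerN2 ler_pdivlMr.
have C0 : 0 <= 'C(m, j)%:R * D' ^+ j by rewrite mulr_ge0 ?exprn_ge0.
apply: (le_trans (ler_pM C0 (exprn_ge0 _ sD) h1 h2)).
rewrite le_eqVlt; apply/orP; left; apply/eqP.
by rewrite mulrACA -exprD subnKC.
Qed.

(** In a window of size [eta] around [x], the ratios of [1 - a] and [1 - b] to
the survival probability [s] are close to [1]: they change the slopes [alpha +
del], [alpha - del] into [alpha + tau], [alpha - tau] at most. *)
Lemma slope_window_arith (alpha tau del x eta s a b : R) :
  0 < x < 1 -> 0 < del -> tau = 2 * del -> tau < alpha - 1 ->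
  eta * ((alpha + del) * (1 + alpha + tau)) <= del * (1 - x) ->
  `|a - x| < eta -> `|b - x| < eta ->
  `|s - (1 - x)| <= (alpha + del) * eta ->
  [/\ (1 - a) * (alpha + del) <= (alpha + tau) * s,
      (alpha - tau) * s <= (1 - b) * (alpha - del) & 0 < s].
Proof.
move=> /andP[x0 x1] d0 ->{tau} ta etaK ae be sx.
have eta0 : 0 < eta by apply: le_lt_trans ae.
pose g := (alpha + del) * eta.
have ad1 : 1 <= alpha + del by lra.
have g0 : 0 < g by rewrite mulr_gt0//; lra.
have gK : g * (1 + alpha + 2 * del) <= del * (1 - x) by apply: le_trans etaK; rewrite /g; lra.
have h3 : eta * (alpha - del) <= g by rewrite /g mulrC ler_wpM2r//; lra.
have gE : eta * (alpha + del) = g by rewrite mulrC.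
have h4 : 0 <= 2 * del * g by rewrite mulr_ge0//; lra.
move: sx ae be; rewrite -/g; clearbody g; clear etaK.
rewrite !ltr_norml !ler_norml => /andP[s1 s2] /andP[a1 _] /andP[_ b2].
split.
- have h1 : (1 - a) * (alpha + del) <= (1 - x + eta) * (alpha + del).
    by rewrite ler_wpM2r//; lra.
  have h2 : (alpha + 2 * del) * (1 - x - g) <= (alpha + 2 * del) * s.
    by rewrite ler_wpM2l//; lra.
  by apply: (le_trans h1); apply: le_trans h2; lra.
- have h1 : (1 - x - eta) * (alpha - del) <= (1 - b) * (alpha - del).
    by rewrite ler_wpM2r//; lra.
  have h2 : (alpha - 2 * del) * s <= (alpha - 2 * del) * (1 - x + g).
    by rewrite ler_wpM2l//; lra.
  by apply: (le_trans h2); apply: le_trans h1; lra.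
have h1 : 0 < (1 + alpha + 2 * del) * (1 - x - g).
  have : 0 < (1 + alpha + 2 * del - del) * (1 - x) by rewrite mulr_gt0//; lra.
  by move: gK; lra.
by rewrite pmulr_rgt0 in h1; lra.
Qed.

(** Two consecutive indices [k] and [l = k + 1] are never both equilibria: the
player that stops at [l] but not at [k] should stop at the level [(l - 1) / n]
already, which is [k / n]. So the weight for [l - k = 1] is [0], and the sum of
the others can be compared with an integral over [u >= 1]. *)
Lemma pair_prob_le (p : R -> R) (x alpha : R) : 0 < x < 1 -> p x = x ->
  strictly_derivable p x alpha -> 1 < alpha -> (forall a, 0 <= p a <= 1) ->
  exists2 eta, 0 < eta & forall n k l : nat, (k < l <= n)%N ->
    `|x - k%:R / n%:R| < eta -> `|x - l%:R / n%:R| < eta ->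
    pair_prob p n k l <= visit_prob p n k *
      (if (l - k == 1)%N then 0 else revisit_weight (- a0 alpha) (l - k)).
Proof.
move=> /andP[x0 x1] px dp al1 p01.
pose tau : R := - a0 alpha / 16.
have a00 := a0_lt0 al1.
have t0 : 0 < tau by rewrite /tau; lra.
have ta : tau < alpha - 1.
  by have := ln_gt0 al1; rewrite /tau /a0; lra.
pose del := tau / 2.
have d0 : 0 < del by rewrite /del; lra.
have [eta1 eta10 lin] := dp del d0.
pose K := (alpha + del) * (1 + alpha + tau).
have K0 : 0 < K by rewrite /K mulr_gt0//; lra.
pose eta := Num.min eta1 (del * (1 - x) / K).
have y0 : 0 < 1 - x by lra.
have eta0 : 0 < eta by rewrite /eta lt_min eta10 divr_gt0// mulr_gt0.
have etaK : eta * K <= del * (1 - x) by rewrite -ler_pdivlMr// /eta ge_min lexx orbT.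
exists eta => // n k l /andP[kl ln] ka la.
have n0 : (0 < n)%N by rewrite (leq_trans _ ln)// (leq_ltn_trans _ kl).
have n0' : (0 : R) < n%:R by rewrite ltr0n.
set a := k%:R / n%:R in ka *; set b := l%:R / n%:R in la *.
pose b' : R := (l%:R - 1) / n%:R.
have jE : (l - k)%:R = l%:R - k%:R :> R by rewrite natrB// ltnW.
have nb : n%:R * b = l%:R by rewrite mulrC divfK// lt0r_neq0.
have na : n%:R * a = k%:R by rewrite mulrC divfK// lt0r_neq0.
have nb' : n%:R * b' = l%:R - 1 by rewrite mulrC divfK// lt0r_neq0.
have klR : k%:R + 1 <= l%:R :> R by rewrite natr1 ler_nat.
have ab' : a <= b' by rewrite ler_pM2r ?invr_gt0//; lra.
have bb' : b' <= b by rewrite ler_pM2r ?invr_gt0//; lra.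
have near1 z : `|x - z| < eta -> `|z - x| < eta1.
  by rewrite distrC => /lt_le_trans; apply; rewrite /eta ge_min lexx.
have b'x : `|b' - x| < eta1.
  move: (near1 _ ka) (near1 _ la); rewrite !ltr_norml; lra.
have linab := lin a b (near1 _ ka) (near1 _ la).
have linab' := lin a b' (near1 _ ka) b'x.
have linxa : `|p a - p x - alpha * (a - x)| <= del * `|a - x|.
  by apply: lin; rewrite ?subrr ?normr0//; exact: near1.
have bin : `|b - a| = b - a by rewrite ger0_norm// subr_ge0 (le_trans ab').
have bin' : `|b' - a| = b' - a by rewrite ger0_norm// subr_ge0.
rewrite bin in linab; rewrite bin' in linab'.
move: linab linab'; rewrite !ler_norml => /andP[lD _] /andP[lD' uD'].
set s := 1 - p a.
set D := p b - p a in lD *; set D' := p b' - p a in lD' uD' *.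
have nba : n%:R * (b - a) = (l - k)%:R by rewrite mulrBr nb na jE.
have nba' : n%:R * (b' - a) = (l - k)%:R - 1 by rewrite mulrBr nb' na jE; ring.
have nD : (alpha - del) * (l - k)%:R <= n%:R * D.
  by rewrite -nba mulrCA ler_pM2l//; lra.
have nD' : n%:R * D' <= (alpha + del) * ((l - k)%:R - 1).
  by rewrite -nba' mulrCA ler_pM2l//; lra.
have ab0 : 0 <= b' - a by rewrite subr_ge0.
have D'0 : 0 <= D'.
  apply: le_trans (_ : (alpha - del) * (b' - a) <= _); last lra.
  by rewrite mulr_ge0//; rewrite /del; lra.
have ae : `|a - x| < eta by rewrite distrC.
have be : `|b - x| < eta by rewrite distrC.
have sx : `|s - (1 - x)| <= (alpha + del) * eta.
  have -> : s - (1 - x) = - ((p a - p x - alpha * (a - x)) + alpha * (a - x)).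
    by rewrite /s px; ring.
  rewrite normrN (le_trans (ler_normD _ _))// mulrDl addrC lerD//.
    by rewrite normrM gtr0_norm; [rewrite ler_pM2l; [exact: ltW|lra]|lra].
  by apply: (le_trans linxa); rewrite ler_pM2l// ltW.
have dt : tau = 2 * del by rewrite /del mulrC divfK.
have x01 : 0 < x < 1 by rewrite x0.
have [up low s0] := slope_window_arith x01 d0 dt ta etaK ae be sx.
have sD : s - D = 1 - p b by rewrite /s /D; ring.
have sD0 : 0 <= s - D by rewrite sD subr_ge0; case/andP: (p01 b).
have pairE : pair_prob p n k l = 'C(n, k)%:R * p ((k%:R - 1) / n%:R) ^+ k *
    ('C(n - k, l - k)%:R * D' ^+ (l - k) * (s - D) ^+ (n - k - (l - k))).
  rewrite /pair_prob -/a -/b -/b' sD -subnDA subnKC; last exact: ltnW.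
  by rewrite /D'; ring.
have visE : visit_prob p n k = 'C(n, k)%:R * p ((k%:R - 1) / n%:R) ^+ k * s ^+ (n - k) by [].
have pk0 : 0 <= 'C(n, k)%:R * p ((k%:R - 1) / n%:R) ^+ k.
  by rewrite mulr_ge0// exprn_ge0//; case/andP: (p01 ((k%:R - 1) / n%:R)).
rewrite pairE visE -[leRHS]mulrA ler_wpM2l//.
case: ifPn => [/eqP jeq1|jne1].
  have -> : D' = 0.
    have -> : D' = p b' - p a by [].
    have -> : b' = a; last by rewrite subrr.
    by rewrite /b' /a; congr (_ / _); rewrite jeq1 in jE; lra.
  by rewrite jeq1 expr1 !mulr0 mul0r.
have knn : (k <= n)%N by rewrite ltnW// (leq_trans kl).
have jn : (l - k <= n - k)%N by rewrite leq_sub2r.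
have nk : (n - k)%:R = n%:R * (1 - a) by rewrite natrB// mulrBr na mulr1.
have nl : (n - k - (l - k))%:R = n%:R * (1 - b).
  by rewrite -subnDA subnKC ?(ltnW kl)// natrB// mulrBr nb mulr1.
have j1 : 0 <= (l - k)%:R - 1 :> R by rewrite subr_ge0 ler1n subn_gt0.
have hA : (n - k)%:R * D' <= ((alpha + tau) * ((l - k)%:R - 1)) * s.
  have a1' : 0 <= 1 - a by rewrite subr_ge0 ler_pdivrMr// mul1r ler_nat.
  have -> : (n - k)%:R * D' = (1 - a) * (n%:R * D') by rewrite nk mulrAC mulrC.
  apply: (le_trans (ler_wpM2l a1' nD')).
  by rewrite mulrA [leRHS]mulrAC ler_wpM2r.
have hB : ((alpha - tau) * (l - k)%:R) * s <= (n - k - (l - k))%:R * D.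
  have b1' : 0 <= 1 - b by rewrite subr_ge0 ler_pdivrMr// mul1r ler_nat.
  have -> : (n - k - (l - k))%:R * D = (1 - b) * (n%:R * D) by rewrite nl mulrAC mulrC.
  apply: le_trans (ler_wpM2l b1' nD).
  by rewrite mulrA mulrAC ler_wpM2r.
apply: (le_trans (thinned_binomial_le jn s0 D'0 sD0 hA hB)).
rewrite ler_pM2l ?exprn_gt0//; apply: poisson_term_le => //.
by rewrite subn_gt0.
Qed.

End revisits.

(** * The second moment method *)

Section second_moment.
Context d (T : measurableType d) (R : realType) (P : probability T R).

Lemma measurable_weighted_indic (I : finType) (Q : pred I) (c : I -> R)
    (B : I -> set T) : (forall i, measurable (B i)) ->
  measurable_fun setT (fun w => \sum_(i | Q i) c i * \1_(B i) w).
Proof.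
move=> mB; under eq_fun do rewrite -big_filter.
by apply: measurable_sum => i; exact: measurable_funM.
Qed.

Lemma integral_weighted_indic (I : finType) (Q : pred I) (c : I -> R)
    (B : I -> set T) : (forall i, 0 <= c i) -> (forall i, measurable (B i)) ->
  (\int[P]_w (\sum_(i | Q i) c i * \1_(B i) w)%:E =
   (\sum_(i | Q i) c i * fine (P (B i)))%:E)%E.
Proof.
move=> c0 mB.
rewrite -(big_filter _ Q); under eq_integral do rewrite -sumEFin -big_filter.
rewrite ge0_integral_sum//; last by move=> i w _; rewrite lee_fin mulr_ge0.
  rewrite -sumEFin; apply: eq_bigr => i _.
  under eq_integral do rewrite EFinM.
  rewrite ge0_integralZl_EFin//; last by apply/measurable_EFinP; exact: measurable_indic.
  by rewrite integral_indic// setIT EFinM fineK// fin_num_measure.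
move=> i; apply/measurable_EFinP; exact: measurable_funM.
Qed.


Lemma sum_pairs_split N (Q : pred 'I_N) (F : 'I_N -> 'I_N -> R) :
  (forall k l, F k l = F l k) ->
  \sum_(k | Q k) \sum_(l | Q l) F k l =
  \sum_(k | Q k) F k k + 2 * \sum_(k | Q k) \sum_(l | Q l && (k < l)%N) F k l.
Proof.
move=> Fsym.
have E k : Q k -> \sum_(l | Q l) F k l = F k k +
    (\sum_(l | Q l && (k < l)%N) F k l + \sum_(l | Q l && (l < k)%N) F k l).
  move=> Qk; rewrite (bigD1 k)//=; congr (_ + _).
  rewrite (bigID (fun l : 'I_N => (k < l)%N))/=; congr (_ + _); apply: eq_bigl => l.
    by rewrite -andbA; congr (_ && _); rewrite -val_eqE/=; case: ltngtP.
  by rewrite -andbA; congr (_ && _); rewrite -val_eqE/=; case: ltngtP.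
rewrite (eq_bigr _ E) big_split/=; congr (_ + _).
rewrite big_split/= mulr_natl mulr2n; congr (_ + _).
rewrite (exchange_big_dep Q)/=; last by move=> k l _ /andP[].
apply: eq_bigr => l Ql; apply: eq_big => [k|k _]; last exact: Fsym.
by rewrite Ql.
Qed.

(** Let [Z] be the number of events that occur. Then [2 t Z - (t Z) ^ 2 <= 1]
when one of them does, and the left-hand side is [0] otherwise. As the
hypotheses give [E Z ^ 2 <= (1 + 2 S) E Z], the best choice is [t = 1 / (1 + 2
S)]. *)
Lemma second_moment_union N (Q : pred nat) (A : nat -> set T)
    (m : nat -> R) (q : nat -> nat -> R) (S : R) :
  0 <= S -> (forall k, measurable (A k)) ->
  (forall k, (k < N)%N -> Q k -> P (A k) = (m k)%:E) ->
  (forall k l, (k < l < N)%N -> Q k -> Q l -> (P (A k `&` A l) <= (q k l)%:E)%E) ->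
  (forall k, (k < N)%N -> Q k ->
     \sum_(0 <= l < N | Q l && (k < l)%N) q k l <= S * m k) ->
  (((\sum_(0 <= k < N | Q k) m k) / (1 + 2 * S))%:E <=
    P (\bigcup_(k in [set k | (k < N)%N /\ Q k]) A k))%E.
Proof.
move=> S0 mA Pm Pq qS; rewrite big_mkord.
set U := \bigcup_(_ in _) _.
have mU : measurable U by apply: bigcup_measurable => k _.
pose t : R := (1 + 2 * S)^-1.
have S1 : 0 < 1 + 2 * S by lra.
have t0 : 0 < t by rewrite invr_gt0.
pose B (i : 'I_N * 'I_N) := A i.1 `&` A i.2.
have mB i : measurable (B i) by exact: measurableI.
pose z w : R := \sum_(k < N | Q k) \1_(A k) w.
have zz w : \sum_(i : 'I_N * 'I_N | Q i.1 && Q i.2) t ^+ 2 * \1_(B i) w = (t * z w) ^+ 2.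
  rewrite -(pair_big (fun k : 'I_N => Q k) (fun k : 'I_N => Q k)
      (fun k l => t ^+ 2 * \1_(A k `&` A l) w))/=.
  rewrite exprMn [z w ^+ 2]expr2 /z big_distrl mulr_sumr/=; apply: eq_bigr => k _.
  rewrite -mulr_sumr; congr (_ * _); rewrite big_distrr/=; apply: eq_bigr => l _.
  by rewrite indicI.
have pointwise w : \sum_(k < N | Q k) (2 * t) * \1_(A k) w <=
    \1_U w + \sum_(i : 'I_N * 'I_N | Q i.1 && Q i.2) t ^+ 2 * \1_(B i) w.
  rewrite zz -mulr_sumr -/(z w).
  have [Uw|Uw] := pselect (U w).
    rewrite indicE mem_set//=; have := sqr_ge0 (1 - t * z w); lra.
  have -> : z w = 0.
    rewrite /z big1// => k Qk; rewrite indicE memNset// => Akw; apply: Uw.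
    by exists k.
  by rewrite !mulr0 expr2 mulr0 addr0 indicE.
have int1 := @integral_weighted_indic _ (fun k : 'I_N => Q k) (fun=> 2 * t) (fun k => A k).
have int2 := @integral_weighted_indic _ (fun i : 'I_N * 'I_N => Q i.1 && Q i.2) (fun=> t ^+ 2) B.
have le_int : ((\sum_(k < N | Q k) 2 * t * fine (P (A k)))%:E <= P U +
    (\sum_(i : 'I_N * 'I_N | Q i.1 && Q i.2) t ^+ 2 * fine (P (B i)))%:E)%E.
  rewrite -int1//; last by move=> _; rewrite mulr_ge0// ltW.
  rewrite -int2//; last by move=> _; rewrite sqr_ge0.
  have -> : P U = (\int[P]_w (\1_U w)%:E)%E by rewrite integral_indic// setIT.
  rewrite -ge0_integralD//; last 3 first.
  - exact/measurable_EFinP.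
  - by move=> w _; rewrite lee_fin sumr_ge0// => i _; rewrite mulr_ge0// sqr_ge0.
  - by apply/measurable_EFinP; exact: measurable_weighted_indic.
  apply: ge0_le_integral => //.
  - by move=> w _; rewrite lee_fin sumr_ge0// => k _; rewrite !mulr_ge0// ltW.
  - by apply/measurable_EFinP; exact: measurable_weighted_indic.
  - apply/measurable_EFinP; apply: measurable_funD => //.
    exact: measurable_weighted_indic.
  - by move=> w _; rewrite -EFinD lee_fin.
pose F (k l : 'I_N) : R := fine (P (A k `&` A l)).
have Fm (k : 'I_N) : Q k -> fine (P (A k)) = m k by move=> Qk; rewrite Pm.
have sumF : \sum_(i : 'I_N * 'I_N | Q i.1 && Q i.2) t ^+ 2 * fine (P (B i)) <=
    t * \sum_(k < N | Q k) m k.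
  rewrite -mulr_sumr -(pair_big (fun k : 'I_N => Q k) (fun k : 'I_N => Q k) F)/=.
  rewrite sum_pairs_split; last by move=> k l; rewrite /F setIC.
  have -> : \sum_(k < N | Q k) F k k = \sum_(k < N | Q k) m k.
    by apply: eq_bigr => k Qk; rewrite /F setIid Fm.
  have Fq : \sum_(k < N | Q k) \sum_(l < N | Q l && (k < l)%N) F k l <=
      S * \sum_(k < N | Q k) m k.
    rewrite mulr_sumr; apply: ler_sum => k Qk.
    apply: le_trans (qS k (ltn_ord k) Qk); rewrite big_mkord; apply: ler_sum => l /andP[Ql kl].
    rewrite /F -lee_fin fineK ?fin_num_measure//; last exact: measurableI.
    by apply: Pq => //; rewrite kl ltn_ord.
  rewrite expr2 -mulrA ler_pM2l//.
  have tS : t * (1 + 2 * S) = 1 by rewrite mulVf// lt0r_neq0.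
  apply: (@le_trans _ _ (t * ((1 + 2 * S) * \sum_(k < N | Q k) m k))).
    by rewrite ler_pM2l// [leRHS]mulrDl mul1r lerD2l -mulrA ler_pM2l.
  by rewrite mulrA tS mul1r.
have PUfin : P U \is a fin_num by rewrite fin_num_measure.
rewrite -(fineK PUfin) -EFinD lee_fin in le_int.
rewrite -(fineK PUfin) lee_fin mulrC -/t.
have : \sum_(k < N | Q k) 2 * t * fine (P (A k)) = 2 * t * \sum_(k < N | Q k) m k.
  by rewrite mulr_sumr; apply: eq_bigr => k Qk; rewrite Fm.
move: le_int sumF => + + sE; rewrite sE; clear.
move: (\sum_(i | _) _) (\sum_(i | _) _) => u v; lra.
Qed.

End second_moment.

(** * Independent signals *)

Section cylinders.
Context d (T : measurableType d) (R : realType) (P : probability T R).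
Variable X : nat -> {RV P >-> R}.
Hypothesis iidX : iid X.

Definition law (B : set R) : R := fine (P (X 0%N @^-1` B)).

Lemma measurable_preimage_RV i (B : set R) : measurable B -> measurable (X i @^-1` B).
Proof. by move=> mB; rewrite -[X in measurable X]setTI; exact: measurable_funP. Qed.

Lemma lawE i B : measurable B -> P (X i @^-1` B) = (law B)%:E.
Proof.
move=> mB; have -> : P (X i @^-1` B) = P (X 0%N @^-1` B) by exact: iidX.2.
by rewrite /law fineK// fin_num_measure//; exact: measurable_preimage_RV.
Qed.

Definition cylinder n (B : 'I_n -> set R) : set T :=
  [set w | forall i : 'I_n, B i (X i w)].

Lemma cylinder_bigcap n (B : 'I_n -> set R) :
  cylinder B = \bigcap_(i in [set: 'I_n]) (X i @^-1` B i).
Proof. by apply/seteqP; split => w /= h i; [move=> _|]; exact: h. Qed.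

Lemma measurable_cylinder n (B : 'I_n -> set R) :
  (forall i, measurable (B i)) -> measurable (cylinder B).
Proof.
move=> mB; rewrite cylinder_bigcap; apply: fin_bigcap_measurable => //.
by move=> i _; exact: measurable_preimage_RV.
Qed.

Lemma prob_cylinder n (B : 'I_n -> set R) : (forall i, measurable (B i)) ->
  P (cylinder B) = (\prod_(i < n) law (B i))%:E.
Proof.
move=> mB.
(* independence is about sets indexed by [nat]: the family is extended by [setT] *)
pose B' j : set R := if insub j is Some i then B i else setT.
have B'E (i : 'I_n) : B' i = B i by rewrite /B' insubT//= => ?; congr B; exact: val_inj.
have mB' j : measurable (B' j).
  by rewrite /B'; case: insub.
pose J : {fset nat} := [fset j in iota 0 n]%fset.
have memJ j : (j \in J) = (j < n)%N by rewrite !inE/= mem_iota add0n.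
have -> : cylinder B = \bigcap_(j in [set` J]) (X j @^-1` B' j).
  apply/seteqP; split => w /= h.
    by move=> j; rewrite /= memJ => jn; move: (h (Ordinal jn)); rewrite -B'E.
  by move=> i; rewrite -B'E; apply: h; rewrite /= memJ.
rewrite iidX.1//.
have pJ : perm_eq J (index_iota 0 n).
  apply: uniq_perm; [exact: fset_uniq|exact: iota_uniq|].
  by move=> j; rewrite memJ mem_index_iota.
rewrite (perm_big _ pJ)/= big_mkord.
rewrite (eq_bigr (fun i : 'I_n => (law (B i))%:E)); last first.
  by move=> i _; rewrite B'E lawE.
by rewrite prodEFin.
Qed.

Lemma law_ge0 B : 0 <= law B.
Proof. by rewrite /law fine_ge0. Qed.

End cylinders.

(** * The probability of equilibria *)

Section equilibrium_events.
Context d (T : measurableType d) (R : realType) (P : probability T R).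
Variables (X : nat -> {RV P >-> R}) (r c : R).
Hypotheses (iidX : iid X) (c0 : 0 < c).

(** The probability that a player stops when a fraction [a] of them does. *)
Definition stop_prob (a : R) : R := law X `[r - c * a, +oo[.

Definition visit_event n k : set T :=
  [set w | equilibria r c (fun i => X i w) n k%:Z].

Let stop a : set R := `[r - c * a, +oo[.
Let stay a : set R := `]-oo, r - c * a[.

Let mstop a : measurable (stop a). Proof. exact: measurable_itv. Qed.
Let mstay a : measurable (stay a). Proof. exact: measurable_itv. Qed.

Lemma lawB (A B : set R) : measurable A -> measurable B -> A `<=` B ->
  law X (B `\` A) = law X B - law X A.
Proof.
move=> mA mB AB; rewrite /law.
have -> : X 0%N @^-1` (B `\` A) = (X 0%N @^-1` B) `\` (X 0%N @^-1` A) by [].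
rewrite measureD; last 3 first.
- exact: measurable_preimage_RV.
- exact: measurable_preimage_RV.
- by rewrite ltey_eq fin_num_measure//; exact: measurable_preimage_RV.
rewrite setIidr; last by move=> w; exact: AB.
by rewrite fineB ?fin_num_measure//; exact: measurable_preimage_RV.
Qed.

Lemma law_le (A B : set R) : measurable A -> measurable B -> A `<=` B ->
  law X A <= law X B.
Proof. by move=> mA mB AB; rewrite -subr_ge0 -lawB// law_ge0. Qed.

Lemma lawT : law X setT = 1.
Proof. by rewrite /law preimage_setT probability_setT. Qed.

Lemma law_stay a : law X (stay a) = 1 - stop_prob a.
Proof.
rewrite -lawT -lawB//; congr law.
by rewrite setTD /stay /stop setCitvr.
Qed.

Lemma stop_prob01 a : 0 <= stop_prob a <= 1.
Proof. by rewrite law_ge0/= -lawT law_le. Qed.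

Lemma law_between a b : a <= b ->
  law X `[r - c * b, r - c * a[ = stop_prob b - stop_prob a.
Proof.
move=> ab; rewrite -lawB//; last first.
  by move=> z; rewrite /= !in_itv/= !andbT; apply: le_trans; rewrite lerB// ler_pM2l.
congr law; apply/seteqP; split => z; rewrite /= !in_itv/= ?andbT.
  by move=> /andP[-> zr]; split => //; apply/negP; rewrite -ltNge.
by move=> [-> /negP]; rewrite -ltNge.
Qed.

Let stoppers n (a : R) (w : T) : {set 'I_n} := [set i : 'I_n | r - c * a <= X i w].

Lemma stopped_countE n (k : int) w :
  stopped_count r c (fun i => X i w) n k = #|stoppers n (k%:~R / n%:R) w|.
Proof.
rewrite /stopped_count cardsE; apply: eq_card => i; rewrite [LHS]inE/=.
by rewrite -lerBlDr [RHS]unfold_in.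
Qed.

Let stoppers_sub n a b w : a <= b -> stoppers n a w \subset stoppers n b w.
Proof.
move=> ab; apply/fintype.subsetP => i; rewrite !inE; apply: le_trans.
by rewrite lerB// ler_pM2l.
Qed.

(** The sets of stoppers at two consecutive levels are nested: having the same
cardinality, they are equal. *)
Lemma visit_eventE n k w : (k <= n)%N -> visit_event n k w <->
  #|stoppers n (k%:R / n%:R) w| = k /\
  stoppers n ((k%:R - 1) / n%:R) w = stoppers n (k%:R / n%:R) w.
Proof.
move=> kn; rewrite /visit_event /equilibria /= !stopped_countE rmorphB/= -!pmulrn.
have sub : stoppers n ((k%:R - 1) / n%:R) w \subset stoppers n (k%:R / n%:R) w.
  by apply: stoppers_sub; rewrite ler_wpM2r ?invr_ge0// gerBl.
split => [[_ _ [e1] [e2]]|[e1 e2]]; last by rewrite e2 e1; split.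
by split => //; apply/eqP; rewrite eqEcard sub e1 e2 leqnn.
Qed.

Definition visit_cylinder n k (S : {set 'I_n}) : set T :=
  cylinder X (fun i => if i \in S then stop ((k%:R - 1) / n%:R) else stay (k%:R / n%:R)).

Lemma visit_cylinderP n k (S : {set 'I_n}) w :
  visit_cylinder k S w <->
  stoppers n ((k%:R - 1) / n%:R) w = S /\ stoppers n (k%:R / n%:R) w = S.
Proof.
have sub : stoppers n ((k%:R - 1) / n%:R) w \subset stoppers n (k%:R / n%:R) w.
  by apply: stoppers_sub; rewrite ler_wpM2r ?invr_ge0// gerBl.
split => [h|[h1 h2] i].
  have sS : S \subset stoppers n ((k%:R - 1) / n%:R) w.
    by apply/fintype.subsetP => i iS; have := h i; rewrite iS inE /stop/= in_itv/= andbT.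
  have Ss : stoppers n (k%:R / n%:R) w \subset S.
    apply/fintype.subsetP => i; apply: contraLR => iS; have := h i.
    by rewrite (negbTE iS) inE /stay/= in_itv/= -ltNge.
  by split; apply/eqP;
    rewrite finset.eqEsubset ?sS ?Ss ?(fintype.subset_trans sub)// (fintype.subset_trans sS).
case: ifPn => iS; rewrite /stop /stay /= in_itv/= ?andbT.
  by move: iS; rewrite -h1 inE.
by move: iS; rewrite -h2 inE -ltNge.
Qed.

Lemma prod_if_const n (S : {set 'I_n}) (u v : R) :
  \prod_(i < n) (if i \in S then u else v) = u ^+ #|S| * v ^+ (n - #|S|).
Proof.
rewrite (bigID (mem S))/=; congr (_ * _).
  rewrite (eq_bigr (fun=> u)); last by move=> i /= ->.
  by rewrite prodr_const; congr (_ ^+ _); apply: eq_card.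
rewrite (eq_bigr (fun=> v)); last by move=> i /negbTE ->.
rewrite prodr_const; congr (_ ^+ _).
have := cardC (mem S); rewrite card_ord.
have -> : #|mem S| = #|S| by apply: eq_card.
move=> E; apply: (@addnI #|S|); rewrite subnKC; last by rewrite -[leqRHS]E leq_addr.
by rewrite -[RHS]E; congr (_ + _)%N; apply: eq_card => i; rewrite !inE.
Qed.

Lemma prob_visit_cylinder n k (S : {set 'I_n}) :
  P (visit_cylinder k S) = (stop_prob ((k%:R - 1) / n%:R) ^+ #|S| *
    (1 - stop_prob (k%:R / n%:R)) ^+ (n - #|S|))%:E.
Proof.
rewrite /visit_cylinder prob_cylinder//; last by move=> i; case: ifP.
congr EFin; rewrite -prod_if_const; apply: eq_bigr => i _.
by case: ifP => // _; exact: law_stay.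
Qed.

(** The cylinders are disjoint, because the set of stoppers is determined. *)
Lemma visit_event_cylinder n k w : (k <= n)%N ->
  \1_(visit_event n k) w = \sum_(S : {set 'I_n} | #|S| == k) 1 * \1_(visit_cylinder k S) w :> R.
Proof.
move=> kn; have [Aw|Aw] := pselect (visit_event n k w); last first.
  rewrite indicE memNset// big1// => S /eqP Sk.
  rewrite indicE memNset ?mulr0//= => /visit_cylinderP[h1 h2]; apply: Aw.
  by apply/(visit_eventE _ kn); rewrite h1 h2 Sk.
rewrite indicE mem_set//=; move/(visit_eventE _ kn) : Aw => [e1 e2].
rewrite (bigD1 (stoppers n (k%:R / n%:R) w)) ?e1//= indicE mem_set; last exact/visit_cylinderP.
rewrite mul1r big1 ?addr0// => S /andP[_ /eqP SS]; rewrite indicE memNset ?mulr0//.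
by move=> /visit_cylinderP[_ h2]; apply: SS.
Qed.

Lemma measurable_visit_cylinder n k (S : {set 'I_n}) : measurable (visit_cylinder k S).
Proof. by apply: measurable_cylinder => i; case: ifP. Qed.

Lemma measurable_visit_event n k : (k <= n)%N -> measurable (visit_event n k).
Proof.
move=> kn; have -> : visit_event n k =
    \bigcup_(S in [set S : {set 'I_n} | #|S| = k]) visit_cylinder k S.
  apply/seteqP; split => w.
    move/(visit_eventE _ kn) => [e1 e2]; exists (stoppers n (k%:R / n%:R) w) => //.
    exact/visit_cylinderP.
  by move=> [S /= Sk /visit_cylinderP[h1 h2]]; apply/(visit_eventE _ kn); rewrite h1 h2.
by apply: fin_bigcup_measurable => [|S _]; [exact: finite_finset|exact: measurable_visit_cylinder].
Qed.

Lemma prob_visit_event n k : (k <= n)%N ->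
  P (visit_event n k) = (visit_prob stop_prob n k)%:E.
Proof.
move=> kn; have mA := measurable_visit_event kn.
rewrite -[visit_event n k]setIT -integral_indic//.
under eq_integral do rewrite visit_event_cylinder//.
rewrite integral_weighted_indic//; last by move=> S; exact: measurable_visit_cylinder.
congr EFin; under eq_bigr => S /eqP Sk do rewrite mul1r prob_visit_cylinder/= Sk.
rewrite sumr_const -[LHS]mulr_natl /visit_prob -mulrA; congr (_%:R * _).
rewrite -[X in 'C(X, _)](card_ord n) -card_draws; apply: eq_card => S; rewrite [RHS]inE.
by rewrite unfold_in.
Qed.


Lemma prod_if2_const n (S S' : {set 'I_n}) (u v t : R) : S' \subset ~: S ->
  \prod_(i < n) (if i \in S then u else if i \in S' then v else t) =
  u ^+ #|S| * v ^+ #|S'| * t ^+ (n - #|S| - #|S'|).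
Proof.
move=> SS'; have disj i : i \in S -> i \in S' = false.
  move=> iS; apply/negbTE/negP => /(fintype.subsetP SS').
  by rewrite inE iS.
have E : \prod_(i < n) (if i \in S then u else if i \in S' then v else t) =
    \prod_(i < n) ((if i \in S then u else 1) *
      ((if i \in S' then v else 1) * (if i \in S :|: S' then 1 else t))).
  apply: eq_bigr => i _; rewrite !inE; case: ifPn => iS; last first.
    by rewrite /= mul1r; case: ifP; rewrite ?mulr1 ?mul1r.
  by rewrite (disj _ iS) /= !mulr1.
rewrite E !big_split/= !prod_if_const !expr1n !mulr1 mul1r mulrA.
have -> : #|S :|: S'| = (#|S| + #|S'|)%N.
  rewrite cardsU (_ : S :&: S' = finset.set0) ?cards0 ?subn0//.
  by apply/setP => i; rewrite !inE; apply/negP => /andP[/disj ->].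
by rewrite subnDA.
Qed.

Definition pair_cylinder n k l (SS : {set 'I_n} * {set 'I_n}) : set T :=
  cylinder X (fun i => if i \in SS.1 then stop ((k%:R - 1) / n%:R) else
    if i \in SS.2 then `[r - c * ((l%:R - 1) / n%:R), r - c * (k%:R / n%:R)[%classic
    else stay (l%:R / n%:R)).

Lemma measurable_pair_cylinder n k l (SS : {set 'I_n} * {set 'I_n}) :
  measurable (pair_cylinder k l SS).
Proof. by apply: measurable_cylinder => i; case: ifP => // _; case: ifP. Qed.

Lemma prob_pair_cylinder n k l (SS : {set 'I_n} * {set 'I_n}) : (k < l)%N ->
  SS.2 \subset ~: SS.1 ->
  P (pair_cylinder k l SS) = (stop_prob ((k%:R - 1) / n%:R) ^+ #|SS.1| *
    (stop_prob ((l%:R - 1) / n%:R) - stop_prob (k%:R / n%:R)) ^+ #|SS.2| *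
    (1 - stop_prob (l%:R / n%:R)) ^+ (n - #|SS.1| - #|SS.2|))%:E.
Proof.
move=> kl sub; rewrite /pair_cylinder prob_cylinder//; last first.
  by move=> i; case: ifP => // _; case: ifP.
congr EFin; rewrite -prod_if2_const//; apply: eq_bigr => i _.
case: ifP => // _; case: ifP => _; last exact: law_stay.
rewrite law_between// ler_wpM2r ?invr_ge0//.
by rewrite lerBrDr natr1 ler_nat.
Qed.

Let pair_index n k l : pred ({set 'I_n} * {set 'I_n}) :=
  fun SS => (#|SS.1| == k) && ((SS.2 \subset ~: SS.1) && (#|SS.2| == l - k)%N).

(** The stoppers at the level [k] and those that join them before the level [l]
provide the pair that indexes a cylinder containing [w]. *)
Lemma visit_pair_cylinder n k l w : (k < l <= n)%N ->
  \1_(visit_event n k `&` visit_event n l) w <=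
  \sum_(SS | @pair_index n k l SS) 1 * \1_(pair_cylinder k l SS) w :> R.
Proof.
move=> /andP[kl ln]; have kn : (k <= n)%N by rewrite (leq_trans _ ln)// ltnW.
have [Aw|Aw] := pselect ((visit_event n k `&` visit_event n l) w); last first.
  by rewrite indicE memNset// sumr_ge0// => i _; rewrite mul1r.
have [/(visit_eventE _ kn)[k1 k2] /(visit_eventE _ ln)[l1 l2]] := Aw.
set Sk := stoppers n (k%:R / n%:R) w in k1 k2.
set Sl := stoppers n (l%:R / n%:R) w in l1 l2.
have sub : Sk \subset Sl.
  by apply: stoppers_sub; rewrite ler_wpM2r ?invr_ge0// ler_nat ltnW.
have idx : pair_index k l (Sk, Sl :\: Sk).
  rewrite /pair_index/= k1 eqxx cardsD (finset.setIidPr sub) k1 l1 eqxx andbT.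
  by apply/fintype.subsetP => i; rewrite !inE => /andP[].
rewrite (bigD1 (Sk, Sl :\: Sk))//= [X in _ <= X + _]mul1r.
rewrite [X in _ <= X + _]indicE mem_set/=; last first.
  move=> i /=; case: ifPn => iSk.
    by move: iSk; rewrite -k2 inE /stop/= in_itv/= andbT.
  rewrite finset.in_setD iSk /=; case: ifPn => iSl.
    rewrite /= in_itv/=; apply/andP; split; first by move: iSl; rewrite -l2 inE.
    by move: iSk; rewrite inE -ltNge.
  by move: iSl; rewrite inE -ltNge /stay/= in_itv.
rewrite indicE; apply: (@le_trans _ _ 1); first by case: (_ \in _).
by rewrite lerDl sumr_ge0// => i _; rewrite mul1r.
Qed.

Lemma prob_visit_pair_le n k l : (k < l <= n)%N ->
  (P (visit_event n k `&` visit_event n l) <= (pair_prob stop_prob n k l)%:E)%E.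
Proof.
move=> /[dup] kln /andP[kl ln]; have kn : (k <= n)%N by rewrite (leq_trans _ ln)// ltnW.
have mA : measurable (visit_event n k `&` visit_event n l).
  by apply: measurableI; exact: measurable_visit_event.
rewrite -[X in P X]setIT -integral_indic//.
apply: (@le_trans _ _ (\int[P]_w (\sum_(SS | @pair_index n k l SS)
    1 * \1_(pair_cylinder k l SS) w)%:E)%E).
  apply: ge0_le_integral => //.
  - exact/measurable_EFinP.
  - apply/measurable_EFinP; apply: measurable_weighted_indic => SS.
    exact: measurable_pair_cylinder.
  - by move=> w _; rewrite lee_fin; exact: visit_pair_cylinder.
rewrite integral_weighted_indic//; last by move=> SS; exact: measurable_pair_cylinder.
rewrite lee_fin /pair_index.
rewrite -(pair_big_dep (fun S : {set 'I_n} => #|S| == k)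
   (fun S S' : {set 'I_n} => (S' \subset ~: S) && (#|S'| == l - k)%N)
   (fun S S' => 1 * fine (P (pair_cylinder k l (S, S')))))/=.
set W := stop_prob ((k%:R - 1) / n%:R) ^+ k *
  (stop_prob ((l%:R - 1) / n%:R) - stop_prob (k%:R / n%:R)) ^+ (l - k) *
  (1 - stop_prob (l%:R / n%:R)) ^+ (n - l).
have inner (S : {set 'I_n}) : #|S| == k ->
    \sum_(S' : {set 'I_n} | (S' \subset ~: S) && (#|S'| == l - k)%N)
      1 * fine (P (pair_cylinder k l (S, S'))) = 'C(n - k, l - k)%:R * W.
  move=> /eqP Sk.
  rewrite (eq_bigr (fun=> W)); last first.
    move=> S' /andP[sub /eqP S'k]; rewrite mul1r prob_pair_cylinder//= Sk S'k.
    by rewrite -subnDA subnKC// ltnW.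
  rewrite sumr_const -[LHS]mulr_natl; congr (_%:R * _).
  have <- : #|~: S| = (n - k)%N by rewrite cardsCs finset.setCK card_ord Sk.
  by rewrite -cards_draws; apply: eq_card => S'; rewrite [RHS]inE unfold_in.
rewrite (eq_bigr _ inner) sumr_const -[leLHS]mulr_natl /pair_prob.
have -> : #|(fun S : {set 'I_n} => #|S| == k)| = 'C(n, k).
  rewrite -[X in 'C(X, _)](card_ord n) -card_draws; apply: eq_card => S.
  by rewrite [RHS]inE unfold_in.
by rewrite /W !mulrA.
Qed.

End equilibrium_events.

(** * From the density to the slope of [stop_prob] *)

Section density.
Context d (T : measurableType d) (R : realType) (P : probability T R).
Variables (X : nat -> {RV P >-> R}) (r c : R) (f : R -> R).
Hypotheses (iidX : iid X) (c0 : 0 < c) (X0 : forall w, 0 <= X 0%N w).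
Hypothesis df : continuous_density (X 0%N) f.
Local Notation mu := (@lebesgue_measure R).

Let mf : measurable_fun setT f. Proof. by case: df. Qed.
Let f0 y : 0 <= f y. Proof. by case: df. Qed.

Lemma cdf_law y : cdf (X 0%N) y = (law X `]-oo, y])%:E.
Proof. by rewrite /law fineK// fin_num_measure//; exact: measurable_preimage_RV. Qed.

Lemma law_itvoc u v : u <= v ->
  (law X `]u, v])%:E = (\int[mu]_(z in `]u, v]) (f z)%:E)%E.
Proof.
move=> uv; have [_ _ F _] := df.
have := F v; have -> : `]-oo, v]%classic = `]-oo, u] `|` `]u, v].
  by rewrite -itv_bndbnd_setU// bnd_simp.
rewrite ge0_integral_setU//=; last 3 first.
- by apply/measurable_EFinP; exact: measurable_funTS.
- by move=> z _; rewrite lee_fin.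
- rewrite disj_set2E; apply/eqP/seteqP; split => z //=; rewrite !in_itv/=.
  by move=> [zu /andP[/lt_le_trans/(_ zu)]]; rewrite ltxx.
rewrite -F !cdf_law.
have -> : law X `]u, v] = law X `]-oo, v] - law X `]-oo, u].
  rewrite -lawB//; last by move=> z; rewrite /= !in_itv/= => /le_trans; exact.
  congr law; apply/seteqP; split => z /=; rewrite !in_itv/=.
    by move=> /andP[uz zv]; split => //; apply/negP; rewrite -ltNge.
  by move=> [-> /negP]; rewrite -ltNge => ->.
by move=> H; rewrite EFinB H addeAC subee ?add0e.
Qed.

Lemma law_itvoc_le u v b : u <= v -> (forall z, u < z <= v -> f z <= b) ->
  law X `]u, v] <= b * (v - u).
Proof.
by move=> uv fb; rewrite -lee_fin law_itvoc//; apply: integral_itvoc_le.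
Qed.

Lemma law_itvoc_ge u v b : u <= v -> 0 <= b -> (forall z, u < z <= v -> b <= f z) ->
  b * (v - u) <= law X `]u, v].
Proof.
by move=> uv b0 fb; rewrite -lee_fin law_itvoc//; apply: integral_itvoc_ge.
Qed.

Section near_a_point.
Variables (y0 rho del : R).
Hypotheses (del0 : 0 < del)
  (near_f : forall z, `|z - y0| < rho -> `|f z - f y0| <= del).

(** The distribution function controls the intervals open on the left. The left
end is moved outwards for the upper bound, the right end inwards for the lower
bound; then the displacement [h] tends to [0]. *)
Lemma law_itvco_approx u v : u <= v ->
  `|u - y0| < rho -> `|v - y0| < rho ->
  `|law X `[u, v[ - f y0 * (v - u)| <= del * (v - u).
Proof.
move=> uv ur vr.
have fb z h : 0 < h -> `|u - h - y0| < rho -> u - h < z <= v -> `|f z - f y0| <= del.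
  move=> h0 uh /andP[zu zv]; apply: near_f; move: uh vr; rewrite !ltr_norml; lra.
have fle z h : 0 < h -> `|u - h - y0| < rho -> u - h < z <= v ->
    f y0 - del <= f z <= f y0 + del.
  by move=> h0 uh uz; have := fb z h h0 uh uz; rewrite ler_norml; lra.
have hmax e : 0 < e -> exists2 h, 0 < h < e & `|u - h - y0| < rho.
  move=> e0; exists (Num.min (e / 2) ((u - y0 + rho) / 2)).
    move: ur; rewrite ltr_norml => /andP[ur _].
    by rewrite lt_min !divr_gt0 ?gt_min//; lra.
  move: ur; rewrite !ltr_norml => /andP[ur1 ur2].
  set h := Num.min _ _; have h1 : h <= (u - y0 + rho) / 2 by rewrite /h ge_min lexx orbT.
  have h2 : 0 < h by rewrite lt_min !divr_gt0//; lra.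
  lra.
have up : law X `[u, v[ <= (f y0 + del) * (v - u).
  have fd0 : 0 <= f y0 + del by rewrite addr_ge0// ltW.
  apply/ler_addgt0Pr => e e0.
  have [h /andP[h0 he] uh] := hmax (e / (f y0 + del + 1)) ltac:(by rewrite divr_gt0// ltr_wpDl).
  apply: (@le_trans _ _ (law X `]u - h, v])).
    apply: law_le => // z /=; rewrite !in_itv/= => /andP[uz /ltW ->].
    by rewrite andbT; lra.
  apply: (le_trans (law_itvoc_le (b := f y0 + del) _ _)); first lra.
    by move=> z uz; case/andP: (fle z h h0 uh uz).
  have -> : v - (u - h) = v - u + h by ring.
  rewrite mulrDr lerD2l.
  rewrite ltr_pdivlMr in he; last by rewrite ltr_wpDl.
  by move: he; rewrite mulrDr mulr1; lra.
have low : (f y0 - del) * (v - u) <= law X `[u, v[.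
  have [fd|fd] := leP (f y0 - del) 0.
    by apply: (@le_trans _ _ 0); [rewrite mulr_le0_ge0// subr_ge0|exact: law_ge0].
  apply/ler_addgt0Pr => e e0.
  have [uvE|uvN] := eqVneq u v.
    by rewrite uvE subrr mulr0 addr_ge0 ?law_ge0// ltW.
  have uv' : u < v by rewrite lt_neqAle uvN.
  pose h := Num.min ((v - u) / 2) (e / (f y0 - del)).
  have h0 : 0 < h by rewrite lt_min !divr_gt0//; lra.
  have hv : h <= (v - u) / 2 by rewrite ge_min lexx.
  have he : h <= e / (f y0 - del) by rewrite ge_min lexx orbT.
  have [h' /andP[h'0 _] uh'] := hmax 1 ltr01.
  have le1 : law X `]u, v - h] <= law X `[u, v[.
    apply: law_le => // z /=; rewrite !in_itv/= => /andP[/ltW ->] /=; lra.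
  have ge1 : (f y0 - del) * (v - h - u) <= law X `]u, v - h].
    apply: law_itvoc_ge; [lra|exact: ltW|].
    move=> z /andP[uz zv]; have uz' : u - h' < z <= v by apply/andP; split; lra.
    by case/andP: (fle z h' h'0 uh' uz').
  rewrite ler_pdivlMr// in he.
  apply: le_trans (lerD (le_trans ge1 le1) (lexx e)); lra.
rewrite ler_norml; lra.
Qed.

End near_a_point.

(** The distribution function vanishes on the negative reals, hence also at [0]
because the density makes it continuous. *)
Lemma density_point_gt0 y0 : 0 < law X `]-oo, y0] -> 0 < y0.
Proof.
move=> Fy; rewrite ltNge; apply/negP => y00.
suff : law X `]-oo, 0] <= 0.
  apply/negP; rewrite -ltNge; apply: lt_le_trans Fy _.
  by apply: law_le => // z /=; rewrite !in_itv/= => /le_trans; exact.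
have [_ _ F _] := df.
have F0 n : (\int[mu]_(z in `]-oo, (- n.+1%:R^-1)%R]) (f z)%:E = 0)%E.
  rewrite -F cdf_law /law.
  have -> : X 0%N @^-1` `]-oo, - n.+1%:R^-1] = set0.
    apply/seteqP; split => w //=; rewrite in_itv/= => wn.
    have := le_trans (X0 w) wn; rewrite oppr_ge0.
    by rewrite leNgt invr_gt0 ltr0n.
  by rewrite measure0.
rewrite -lee_fin -cdf_law F -integral_itv_bndo_bndc; last first.
  by apply/measurable_EFinP; exact: measurable_funTS.
have <- : \bigcup_n `]-oo, (- n.+1%:R^-1)]%classic = `]-oo, (0 : R)[%classic.
  apply/seteqP; split => z /=.
    move=> [n _] /=; rewrite !in_itv/= => /le_lt_trans; apply.
    by rewrite oppr_lt0 invr_gt0.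
  rewrite in_itv/= => z0; exists (Num.truncn ((- z)^-1)) => //=; rewrite in_itv/=.
  have z0' : 0 < - z by rewrite oppr_gt0.
  rewrite lerNr invf_ple ?posrE//; apply/ltW; exact: truncnS_gt.
have nd : nondecreasing_seq (fun n => `]-oo, (- n.+1%:R^-1)]%classic : set R).
  move=> n m nm; apply/subsetPset => z /=; rewrite !in_itv/= => /le_trans; apply.
  by rewrite lerN2 lef_pV2 ?posrE// ler_nat ltnS.
have : (\int[mu]_(x in `]-oo, (- n.+1%:R^-1)%R]) (f x)%:E)%E @[n --> \oo] -->
    (\int[mu]_(x in \bigcup_n `]-oo, (- n.+1%:R^-1)%R]%classic) (f x)%:E)%E.
  apply: ge0_nondecreasing_set_cvg_integral => //.
    by move=> n; apply/measurable_EFinP; exact: measurable_funTS.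
  by move=> n z _; rewrite lee_fin.
under eq_fun do rewrite F0.
move=> /cvg_lim <-//; by rewrite lim_cst.
Qed.


Lemma density_near y0 e : 0 < y0 -> 0 < e ->
  exists2 rho, 0 < rho & forall z, `|z - y0| < rho -> `|f z - f y0| <= e.
Proof.
move=> y00 e0; have [_ _ _ /continuous_within_itvcyP[cf _]] := df.
have /cf : y0 \in `]0, +oo[ by rewrite in_itv/= andbT.
move=> /cvgrPdist_le/(_ e e0)[rho /= rho0 H]; exists rho => // z zy.
by rewrite distrC; apply: H; rewrite /= distrC.
Qed.

Lemma stop_prob_strictly_derivable x : 0 < r - c * x ->
  strictly_derivable (stop_prob X r c) x (c * f (r - c * x)).
Proof.
set y0 := r - c * x => y00 e e0.
have [rho rho0 near_f] := density_near y00 (divr_gt0 e0 c0).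
exists (rho / c) => [|a b ax bx]; first exact: divr_gt0.
have th z : `|z - x| < rho / c -> `|(r - c * z) - y0| < rho.
  rewrite ltr_pdivlMr// => zx.
  have -> : r - c * z - y0 = c * (x - z) by rewrite /y0; ring.
  by rewrite normrM gtr0_norm// mulrC distrC.
wlog ab : a b ax bx / a <= b => [hw|].
  have [ab|/ltW ba] := leP a b; first exact: hw.
  have := hw b a bx ax ba; rewrite -normrN (distrC a b) => H.
  by apply: le_trans H; rewrite le_eqVlt; apply/orP; left; apply/eqP; congr Num.norm; ring.
have := law_itvco_approx (divr_gt0 e0 c0) near_f (_ : r - c * b <= r - c * a)
  (th _ bx) (th _ ax).
rewrite lerB ?ler_pM2l// => /(_ isT).
rewrite law_between// (ger0_norm (_ : 0 <= b - a)) ?subr_ge0//.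
have -> : r - c * a - (r - c * b) = c * (b - a) by ring.
by rewrite mulrA [f y0 * c]mulrC mulrA divfK// lt0r_neq0.
Qed.

(** Were the threshold [r - c x] not positive, [x] would be [1]. The equation
for [x] is about signals at most [r - c x], and [stop_prob] about those at
least [r - c x]: a signal equal to [r - c x] has probability [0]. *)
Lemma stop_prob_fixed x : 0 < x < 1 -> (x%:E + cdf (X 0%N) (r - c * x) = 1)%E ->
  0 < r - c * x /\ stop_prob X r c x = x.
Proof.
move=> /andP[x0 x1]; set y0 := r - c * x.
rewrite cdf_law -EFinD => -[Fy].
have y00 : 0 < y0 by apply: density_point_gt0; lra.
split=> //.
have stayE : law X `]-oo, y0[ = 1 - stop_prob X r c x by rewrite -law_stay.
have atom : law X `]-oo, y0] - law X `]-oo, y0[ <= 0.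
  apply/ler_addgt0Pr => e e0; rewrite add0r.
  have [rho rho0 near_f] := density_near y00 ltr01.
  have fy := f0 y0.
  pose h := Num.min (rho / 2) (e / (f y0 + 1)).
  have h0 : 0 < h by rewrite lt_min !divr_gt0//; lra.
  have h1 : h <= rho / 2 by rewrite ge_min lexx.
  have h2 : h <= e / (f y0 + 1) by rewrite ge_min lexx orbT.
  rewrite ler_pdivlMr in h2; last lra.
  rewrite -lawB//; last by move=> z; rewrite /= !in_itv/= => /ltW.
  apply: (@le_trans _ _ (law X `]y0 - h, y0])).
    apply: law_le => //; first exact: measurableD.
    move=> z [] /=; rewrite !in_itv/= => zy /negP; rewrite -leNgt => yz.
    by rewrite zy andbT; lra.
  apply: (le_trans (law_itvoc_le (b := f y0 + 1) _ _)); first lra.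
    move=> z /andP[z1 z2]; have : `|z - y0| < rho by rewrite ltr_norml; lra.
    by move=> /near_f; rewrite ler_norml; lra.
  by rewrite opprB addrCA subrr addr0 mulrC.
have sub : `]-oo, y0[ `<=` `]-oo, y0] by move=> z; rewrite /= !in_itv/= => /ltW.
have := @law_le _ _ _ P X _ _ (measurable_itv _) (measurable_itv _) sub.
lra.
Qed.

End density.

(** * Conclusion *)

Section limits.
Context {R : realType}.
Local Open Scope ereal_scope.

Lemma limn_einf_ge (u : nat -> \bar R) (a : \bar R) :
  (\forall n \near \oo, a <= u n) -> a <= limn_einf u.
Proof.
move=> [N _ Nu]; rewrite limn_einf_lim; apply: lime_ge; first exact: is_cvg_einfs.
exists N => // n /= Nn; apply: le_ereal_inf_tmp => _ [m /= nm <-].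
by apply: Nu => /=; exact: leq_trans nm.
Qed.

Lemma limf_einf_at_right_ge (u : R -> \bar R) (a : \bar R) :
  (forall eps, (0 < eps)%R -> a <= u eps) -> a <= limf_einf u 0%R^'+.
Proof.
move=> au; rewrite limf_einfE.
apply: (@le_trans _ _ (ereal_inf (u @` [set eps : R | (0 < eps)%R]))).
  by apply: le_ereal_inf_tmp => _ [eps /= e0 <-]; exact: au.
apply: ereal_sup_ubound; exists [set eps : R | (0 < eps)%R] => //.
exact: nbhs_right_gt.
Qed.

End limits.

(** For [a > 0], the integral of [exp (- a u) / sqrt (2 pi u)] over [u >= 1].
*)
Definition gauss_tail {R : realType} (a : R) : R :=
  Num.sqrt (2 / a) * (1 - std_normal_cdf (Num.sqrt (2 * a))).

Lemma gauss_tail_ge0 {R : realType} (a : R) : 0 <= gauss_tail a.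
Proof. by rewrite mulr_ge0 ?sqrtr_ge0// subr_ge0; exact: normal_cdf_le1. Qed.

Lemma L_gauss_tail {R : realType} (alpha : R) : 1 < alpha ->
  L alpha = expR (- alpha) / (alpha - 1) / (1 + 2 * gauss_tail (- a0 alpha)).
Proof.
move=> al1; have a00 := a0_lt0 al1.
have G0 := gauss_tail_ge0 (- a0 alpha).
rewrite /L ltr0_norm// -mulrA -/(gauss_tail _).
by field; rewrite !lt0r_neq0//; lra.
Qed.

(** This is the bound on [E Z ^ 2] for the second moment method. *)
Lemma sum_pair_prob_le {R : realType} (p : R -> R) (alpha x eta : R) n k :
  1 < alpha -> (forall a, 0 <= p a <= 1) -> (k < n.+1)%N ->
  `|x - k%:R / n%:R| < eta ->
  (forall l : nat, (k < l <= n)%N -> `|x - l%:R / n%:R| < eta ->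
    pair_prob p n k l <= visit_prob p n k *
      (if (l - k == 1)%N then 0 else revisit_weight (- a0 alpha) (l - k))) ->
  \sum_(0 <= l < n.+1 | (`|x - l%:R / n%:R| < eta) && (k < l)%N) pair_prob p n k l <=
  gauss_tail (- a0 alpha) * visit_prob p n k.
Proof.
move=> al1 p01 kn kx pl; have a00 := a0_lt0 al1.
pose G j := if (j == 1)%N then 0 else revisit_weight (- a0 alpha) j.
have w0 j : 0 <= revisit_weight (- a0 alpha) j :> R.
  by rewrite !mulr_ge0 ?invr_ge0 ?sqrtr_ge0 ?expR_ge0.
have G0 j : 0 <= G j by rewrite /G; case: ifP.
have v0 := @visit_prob_ge0 _ p n k p01.
apply: (@le_trans _ _ (\sum_(0 <= l < n.+1 | (k < l)%N) visit_prob p n k * G (l - k)%N)).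
  rewrite big_nat_cond [leRHS]big_nat_cond.
  rewrite [leRHS](bigID (fun l => `|x - l%:R / n%:R| < eta))/= -[leLHS]addr0.
  apply: lerD; last by apply: sumr_ge0 => l _; rewrite mulr_ge0.
  rewrite [leRHS](eq_bigl (fun l => (0 <= l < n.+1)%N &&
      ((`|x - l%:R / n%:R| < eta) && (k < l)%N))); last first.
    by move=> l; rewrite -andbA; congr (_ && _); rewrite andbC.
  apply: ler_sum => l /andP[ln /andP[lx kl]].
  by apply: pl => //; rewrite kl.
rewrite -mulr_sumr mulrC ler_wpM2r//.
rewrite (@big_cat_nat _ _ _ k.+1)//=.
rewrite big_nat_cond big1 ?add0r; last first.
  by move=> l /andP[/andP[_ lk]]; rewrite ltnNge -ltnS lk.
rewrite big_nat_cond (eq_bigl (fun l => (k.+1 <= l < n.+1)%N)); last first.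
  by move=> l; case: (ltnP k l); rewrite ?andbF//= !andbT.
rewrite -big_nat -[k.+1]add1n big_addn.
under eq_bigr do rewrite addnK.
apply: le_trans (@gauss_tail_sum _ (- a0 alpha) (n.+1 - k) _); last lra.
have [nk|nk] := leqP (n.+1 - k) 1.
  by rewrite !big_geq// (leq_trans nk).
rewrite (big_ltn nk) {1}/G eqxx add0r.
rewrite big_nat_cond [leRHS]big_nat_cond; apply: ler_sum => j /andP[/andP[j2 _] _].
by rewrite /G gtn_eqF.
Qed.

Section conclusion.
Context (R : realType) d (T : measurableType d) (P : probability T R).
Variables (r c : R) (X : nat -> {RV P >-> R}) (f : R -> R) (x alpha : R).
Hypotheses (c0 : 0 < c) (X0 : forall w, 0 <= X 0%N w) (iidX : iid X)
  (df : continuous_density (X 0%N) f) (x01 : 0 < x < 1)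
  (Fx : (x%:E + cdf (X 0%N) (r - c * x) = 1)%E)
  (al : alpha = c * f (r - c * x)) (al1 : 1 < alpha).

Definition close_equilibrium (eps : R) n : set T :=
  [set w | exists k : int, equilibria r c (fun i => X i w) n k /\
     (`|x - k%:~R / n%:R| < eps)%R].

Lemma close_equilibriumE eps n : close_equilibrium eps n =
  \bigcup_(k in [set k : nat | (k < n.+1)%N /\ `|x - k%:R / n%:R| < eps])
    visit_event X r c n k.
Proof.
apply/seteqP; split => w.
  move=> [k [ke kx]]; move: (ke) => -[k0 kn _ _].
  case: k k0 kn ke kx => [k|k]; last by [].
  move=> _ kn ke kx; exists k => //; split => //=.
by move=> [k /= [kn kx] ke]; exists k%:Z; split.
Qed.

(** The second moment method is applied to the indices in a window around [x]
that is no wider than [eps], and small enough for [pair_prob_le] to hold in it.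
*)
Lemma close_equilibrium_prob_ge (kap eps : R) : 0 < kap -> kap < 1 -> 0 < eps ->
  \forall n \near \oo, (((1 - kap) * L alpha)%:E <= P (close_equilibrium eps n))%E.
Proof.
move=> kap0 kap1 eps0.
have [y0 px] := stop_prob_fixed X0 df x01 Fx.
set p := stop_prob X r c in px.
have dp : strictly_derivable p x alpha.
  by rewrite al; exact: (stop_prob_strictly_derivable c0 df).
have p01 a : 0 <= p a <= 1 by exact: stop_prob01.
have [eta0 eta00 pl] := pair_prob_le x01 px dp al1 p01.
pose eta := Num.min eta0 eps.
have e0 : 0 < eta by rewrite lt_min eta00.
have := expected_visits_ge x01 px dp al1 p01 kap0 kap1 e0.
apply: filterS => n EN.
have mA k : measurable (visit_event X r c n k).
  have [kn|kn] := leqP k n; first exact: measurable_visit_event.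
  rewrite (_ : visit_event _ _ _ _ _ = set0)//; apply/seteqP; split => w //= -[_].
  by rewrite lez_nat leqNgt kn.
have G0 := gauss_tail_ge0 (- a0 alpha).
have Pm k : (k < n.+1)%N -> `|x - k%:R / n%:R| < eta ->
    P (visit_event X r c n k) = (visit_prob p n k)%:E.
  by move=> kn _; exact: prob_visit_event.
have Pq k l : (k < l < n.+1)%N -> `|x - k%:R / n%:R| < eta -> `|x - l%:R / n%:R| < eta ->
    (P (visit_event X r c n k `&` visit_event X r c n l) <= (pair_prob p n k l)%:E)%E.
  by move=> kln _ _; exact: prob_visit_pair_le.
have le_eta0 z : `|x - z| < eta -> `|x - z| < eta0.
  by move=> /lt_le_trans; apply; rewrite ge_min lexx.
have qS k : (k < n.+1)%N -> `|x - k%:R / n%:R| < eta ->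
    \sum_(0 <= l < n.+1 | (`|x - l%:R / n%:R| < eta) && (k < l)%N) pair_prob p n k l
    <= gauss_tail (- a0 alpha) * visit_prob p n k.
  move=> kn kx; apply: sum_pair_prob_le => // l kln lx.
  by apply: pl => //; exact: le_eta0.
have := second_moment_union G0 mA Pm Pq qS.
set U := \bigcup_(_ in _) _ => PU.
have UE : U `<=` close_equilibrium eps n.
  rewrite close_equilibriumE => w [k /= [kn kx] kw]; exists k => //=; split => //.
  by apply: lt_le_trans kx _; rewrite ge_min lexx orbT.
apply: (@le_trans _ _ (P U)).
  apply: le_trans PU; rewrite lee_fin L_gauss_tail// mulrA.
  rewrite ler_pM2r; first exact: EN.
  by rewrite invr_gt0; lra.
apply: le_measure => //; rewrite inE.
  by apply: bigcup_measurable => k _; exact: mA.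
by rewrite close_equilibriumE; apply: bigcup_measurable => k _; exact: mA.
Qed.

Lemma L_gt0 : 0 < L alpha.
Proof.
have a1 : 0 < alpha - 1 by rewrite subr_gt0.
have G1 : 0 < 1 + 2 * gauss_tail (- a0 alpha).
  by rewrite ltr_pwDl// mulr_ge0// gauss_tail_ge0.
by rewrite L_gauss_tail// divr_gt0// divr_gt0// expR_gt0.
Qed.

Lemma close_equilibrium_liminf :
  ((L alpha)%:E <= limf_einf
     (fun eps => limn_einf (fun n => P (close_equilibrium eps n))) 0^'+)%E.
Proof.
apply: limf_einf_at_right_ge => eps eps0.
have L0 := L_gt0.
apply/lee_addgt0Pr => e e0.
pose kap := e / (L alpha + e).
have Le0 : 0 < L alpha + e by rewrite addr_gt0.
have kap0 : 0 < kap by rewrite divr_gt0.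
have kap1 : kap < 1 by rewrite ltr_pdivrMr// mul1r ltrDr.
have kE : kap * (L alpha + e) = e by rewrite divfK// lt0r_neq0.
have := limn_einf_ge (close_equilibrium_prob_ge kap0 kap1 eps0).
move=> /(leeD2r e%:E); apply: le_trans; rewrite -EFinD lee_fin.
have : 0 < kap * e by rewrite mulr_gt0.
by move: kE; lra.
Qed.

End conclusion.

Theorem proposition6p13 (R : realType) (d : measure_display)
    (T : measurableType d) (P : probability T R)
    (r c : R) (hc : 0 < c)
    (t : R) (ht : 0 <= t)
    (Y : R -> nat -> {RV P >-> R})
    (hY0 : forall (i : nat) (w : T), 0 <= Y t i w)
    (hYiid : iid (Y t))
    (f : R -> R -> R) (hf : continuous_density (Y t 0%N) (f t))
    (x : R) (hx : 0 < x < 1)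
    (hFx : (x%:E + cdf (Y t 0%N) (r - c * x) = 1)%E)
    (alpha : R) (halpha : alpha = c * f t (r - c * x)) (halpha1 : 1 < alpha) :
  [/\ ((L alpha)%:E <=
        limf_einf (fun eps : R =>
          limn_einf (fun n : nat =>
            P [set w | exists k : int,
                 equilibria r c (fun i => Y t i w) n k /\
                 (`|x - k%:~R / n%:R| < eps)%R]))
        0^'+)%E,
      0 < L alpha
    & a0 alpha < 0].
Proof.
split; [|exact: L_gt0|exact: a0_lt0].
exact: (close_equilibrium_liminf hc (hY0 0%N) hYiid hf hx hFx halpha halpha1).
Qed.
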